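(* Let $F$ be a field, let $n\geq 2$ be an integer and let $m\in\{1,\dots,n-1\}$. Let $\varphi$ and $\psi$ be two non-hyperbolic, separably $(n-1)$-linked and totally separably $m$-linked quadratic $n$-fold Pfister forms over $F$. Then there exists a field extension $K$ of $F$ such that $\varphi_K$ and $\psi_K$ are totally separably $(m+1)$-linked, $\varphi_K$ and $\psi_K$ are not isometric, and neither $\varphi_K$ nor $\psi_K$ is hyperbolic.
   Context: $F$ is a field of arbitrary characteristic. Quadratic forms are considered up to isometry (equality means isometry); $\varphi_K$ denotes scalar extension of $\varphi$ to $K$. The polar form of a quadratic form $\varphi$ is $B_\varphi(v,w)=\varphi(v+w)-\varphi(v)-\varphi(w)$. A quadratic form is hyperbolic if it is an orthogonal sum of hyperbolic planes (forms isometric to $(x,y)\mapsto xy$). $[1,\beta]$ denotes the two-dimensional quadratic form $(x,y)\mapsto x^2+xy+\beta y^2$. A bilinear $r$-fold Pfister form over $F$ is a symmetric bilinear form isometric to $\langle\!\langle\alpha_1,\dots,\alpha_r\rangle\!\rangle=\langle 1,\alpha_1\rangle\otimes\dots\otimes\langle 1,\alpha_r\rangle$ with $\alpha_i\in F^\times$ (the $0$-fold one is $\langle 1\rangle$), where $\langle a_1,\dots,a_s\rangle$ is the diagonal bilinear form. For a symmetric bilinear form $B$ on $V$ and a quadratic form $\varphi$ on $W$, $B\otimes\varphi$ is the quadratic form on $V\otimes_F W$ determined by $(B\otimes\varphi)(v\otimes w)=B(v,v)\varphi(w)$ (with polar form $B\otimes B_\varphi$). A quadratic $n$-fold Pfister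 form over $F$ is a form $\langle\!\langle\alpha_1,\dots,\alpha_{n-1}\rangle\!\rangle\otimes[1,\beta]$ with $\alpha_i\in F^\times$ and $\beta\in F$. For $k\in\{1,\dots,n\}$, a $k$-fold quadratic Pfister form $\rho$ is a factor of an $n$-fold quadratic Pfister form $\pi$ if $\pi=B'\otimes\rho$ for some $(n-k)$-fold bilinear Pfister form $B'$. Two $n$-fold quadratic Pfister forms are separably $k$-linked if some $k$-fold quadratic Pfister form is a factor of both, and totally separably $k$-linked if every $k$-fold quadratic Pfister form is a factor of one if and only if it is a factor of the other.
   Formalization: The case m = n−1 is excluded (total n-linkage is isometry, contradicting the conclusion), the two forms are assumed non-isometric, and Pfister forms are taken nondegenerate (1−4β ≠ 0 in [1,β]); without these the claim fails. *)

(* Defs.v *)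
From HB Require Import structures.
From mathcomp Require Import all_boot all_order all_algebra.
From mathcomp Require Import mxtens ring.

Set Implicit Arguments.
Unset Strict Implicit.
Unset Printing Implicit Defensive.

Import GRing.Theory.
Local Open Scope ring_scope.

(* The quadratic form v |-> v A v^T on F^d.  A need not be symmetric, so all  *)
(* quadratic forms arise in every characteristic; A is determined by the form *)
(* up to an alternating matrix, and all notions below only depend on the form *)
Record qform (F : fieldType) := QForm { qdim : nat; qmx : 'M[F]_qdim }.

Definition qval (F : fieldType) (phi : qform F) (v : 'rV[F]_(qdim phi)) : F :=
  (v *m qmx phi *m v^T) 0 0.

Definition qpolar (F : fieldType) (phi : qform F)
    (v w : 'rV[F]_(qdim phi)) : F :=
  qval (v + w) - qval v - qval w.

Definition qisometric (F : fieldType) (phi psi : qform F) : Prop :=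
  exists f : {linear 'rV[F]_(qdim phi) -> 'rV[F]_(qdim psi)},
    bijective f /\ forall v, qval (f v) = qval v.

Definition qscal (F K : fieldType) (iota : {rmorphism F -> K})
    (phi : qform F) : qform K :=
  QForm (map_mx iota (qmx phi)).

Definition qzero (F : fieldType) : qform F := QForm (0 : 'M[F]_0).

Definition qadd (F : fieldType) (phi psi : qform F) : qform F :=
  QForm (block_mx (qmx phi) 0 0 (qmx psi)).

(* (x, y) |-> x * y *)
Definition hplane (F : fieldType) : qform F :=
  QForm (block_mx 0 1%:M 0 0 : 'M[F]_(1 + 1)).

Definition hyperbolic (F : fieldType) (phi : qform F) : Prop :=
  exists k : nat, qisometric phi (iter k (qadd (hplane F)) (qzero F)).

(* (x, y) |-> x ^+ 2 + x * y + b * y ^+ 2 *)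
Definition qbin (F : fieldType) (b : F) : qform F :=
  QForm (block_mx 1%:M 1%:M 0 b%:M : 'M[F]_(1 + 1)).

(* Symmetric bilinear forms on F^d, given by their Gram matrix.               *)
Record bform (F : fieldType) :=
  BForm { bdim : nat; bmx : 'M[F]_bdim; bmx_sym : bmx^T = bmx }.

Definition bval (F : fieldType) (B : bform F) (v w : 'rV[F]_(bdim B)) : F :=
  (v *m bmx B *m w^T) 0 0.

Definition bisometric (F : fieldType) (B C : bform F) : Prop :=
  exists f : {linear 'rV[F]_(bdim B) -> 'rV[F]_(bdim C)},
    bijective f /\ forall v w, bval (f v) (f w) = bval v w.

(* <a_1, ..., a_s> *)
Definition bdiag (F : fieldType) (s : seq F) : bform F :=
  BForm (tr_diag_mx (\row_(i < size s) s`_i)).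

Fact btens_sym (F : fieldType) (B C : bform F) :
  (bmx B *t bmx C)^T = bmx B *t bmx C.
Proof. by rewrite trmx_tens !bmx_sym. Qed.

Definition btens (F : fieldType) (B C : bform F) : bform F :=
  BForm (btens_sym B C).

(* The form B (x) phi; see qval_qtens and qpolar_qtens.                       *)
Definition qtens (F : fieldType) (B : bform F) (phi : qform F) : qform F :=
  QForm (bmx B *t qmx phi).

(* <<a_1, ..., a_r>> = <1, a_1> (x) ... (x) <1, a_r> *)
Definition bpf (F : fieldType) (s : seq F) : bform F :=
  foldr (fun a B => btens (bdiag [:: 1; a]) B) (bdiag [:: 1]) s.

Definition bpfister (F : fieldType) (r : nat) (B : bform F) : Prop :=
  exists s : seq F,
    [/\ size s = r, all (fun a => a != 0) s & bisometric B (bpf s)].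

(* The condition 1 - 4 * b != 0 says that [1, b] is nondegenerate, i.e. that  *)
(* 'X^2 - 'X + b is separable; it is void in characteristic 2.                *)
Definition qpfister (F : fieldType) (n : nat) (phi : qform F) : Prop :=
  exists (s : seq F) (b : F),
    [/\ (size s).+1 = n, all (fun a => a != 0) s, 1 - 4 * b != 0
      & qisometric phi (qtens (bpf s) (qbin b))].

(* Meant for 1 <= k <= n, rho a k-fold and pi an n-fold Pfister form.         *)
Definition pfactor (F : fieldType) (n k : nat) (rho pi : qform F) : Prop :=
  exists B : bform F, bpfister (n - k) B /\ qisometric pi (qtens B rho).

Definition sep_linked (F : fieldType) (n k : nat) (phi psi : qform F) : Prop :=
  exists rho : qform F,
    [/\ qpfister k rho, pfactor n k rho phi & pfactor n k rho psi].

Definition tot_sep_linked (F : fieldType) (n k : nat)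
    (phi psi : qform F) : Prop :=
  forall rho : qform F,
    qpfister k rho -> (pfactor n k rho phi <-> pfactor n k rho psi).

Lemma qval_hplane (F : fieldType) (x y : F) :
  qval (row_mx x%:M y%:M : 'rV_(qdim (hplane F))) = x * y.
Proof.
rewrite /qval /= mul_row_block tr_row_mx mul_row_col.
rewrite !mulmx0 !addr0 mulmx1 mul0mx add0r tr_scalar_mx.
by rewrite -scalar_mxM mxE mulr1n.
Qed.

Lemma qval_qbin (F : fieldType) (b x y : F) :
  qval (row_mx x%:M y%:M : 'rV_(qdim (qbin b))) = x ^+ 2 + x * y + b * y ^+ 2.
Proof.
rewrite /qval /= mul_row_block tr_row_mx mul_row_col.
rewrite !mulmx0 !addr0 !mulmx1 mulmxDl !tr_scalar_mx -!scalar_mxM.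
by rewrite !mxE !mulr1n addrA -expr2 -mulrA [y * _]mulrC -mulrA -expr2.
Qed.

Lemma qval_qadd (F : fieldType) (phi psi : qform F)
    (v : 'rV_(qdim phi)) (w : 'rV_(qdim psi)) :
  qval (row_mx v w : 'rV_(qdim (qadd phi psi))) = qval v + qval w.
Proof.
rewrite /qval /= mul_row_block tr_row_mx mul_row_col !mulmx0 addr0 add0r.
by rewrite mxE.
Qed.

Lemma qpolarE (F : fieldType) (phi : qform F) (v w : 'rV_(qdim phi)) :
  qpolar v w = (v *m (qmx phi + (qmx phi)^T) *m w^T) 0 0.
Proof.
rewrite mulmxDr mulmxDl.
have -> : v *m (qmx phi)^T *m w^T = (w *m qmx phi *m v^T)^T.
  by rewrite !trmx_mul !trmxK mulmxA.
rewrite /qpolar /qval linearD /= !mulmxDl !mulmxDr !mxE.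
ring.
Qed.

Fact tens_rowE (F : fieldType) p q (A : 'M[F]_p) (C : 'M[F]_q)
    (v v' : 'rV_p) (w w' : 'rV_q) :
  ((v *t w : 'rV_(p * q)) *m (A *t C) *m (v' *t w' : 'rV_(p * q))^T) 0 0
    = (v *m A *m v'^T) 0 0 * (w *m C *m w'^T) 0 0.
Proof.
pose z : 'I_(1 * 1) := 0.
transitivity (((v *t w) *m (A *t C) *m (v' *t w')^T) z z); first by [].
by rewrite trmx_tens !tensmx_mul mxE [(mxtens_unindex z).1]ord1 [(mxtens_unindex z).2]ord1.
Qed.

Lemma qval_qtens (F : fieldType) (B : bform F) (phi : qform F)
    (v : 'rV_(bdim B)) (w : 'rV_(qdim phi)) :
  qval (v *t w : 'rV_(qdim (qtens B phi))) = bval v v * qval w.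
Proof. exact: tens_rowE. Qed.

Lemma qpolar_qtens (F : fieldType) (B : bform F) (phi : qform F)
    (v v' : 'rV_(bdim B)) (w w' : 'rV_(qdim phi)) :
  qpolar (v *t w : 'rV_(qdim (qtens B phi))) (v' *t w')
    = bval v v' * qpolar w w'.
Proof.
rewrite !qpolarE /= trmx_tens bmx_sym.
have -> : bmx B *t qmx phi + bmx B *t (qmx phi)^T
    = bmx B *t (qmx phi + (qmx phi)^T).
  by apply/matrixP => i j; rewrite !mxE -mulrDr.
exact: tens_rowE.
Qed.

(* Main.v *)
From HB Require Import structures.
From mathcomp Require Import all_boot all_order all_algebra all_field.
From mathcomp Require Import mxtens ring boolp classical_sets filter.
Require Import Defs.

Set Implicit Arguments.
Unset Strict Implicit.
Unset Printing Implicit Defensive.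

Import GRing.Theory.
Local Open Scope ring_scope.

(* Write phi = <1, a> rho and psi = <1, b> rho with rho an (n-1)-fold Pfister *)
(* form.  As phi and psi are anisotropic and not isometric, the form          *)
(* omega = <1, - a b> rho is anisotropic.  Over an extension L preserving the *)
(* anisotropy of the three forms, let j : T -> psi be isometric on a subspace *)
(* T of phi with dim T < dim rho, and let y be in phi.  The vectors w of psi  *)
(* such that y |-> w extends j form an affine quadric, whose function field   *)
(* is a quadratic extension of a rational function field.  If phi, psi or     *)
(* omega became isotropic there, it would contain, by Cassels-Pfister         *)
(* descent, a multiple of the form defining the quadric.  For phi and omega   *)
(* this gives a common subform with psi of dimension > dim rho, and then      *)
(* omega, resp. phi, would be isotropic; for psi, Witt's theorem gives that y *)
(* is in T.  So such a w always exists over an extension of L of the same     *)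
(* kind, and by an ultraproduct argument there is K over which all these      *)
(* embedding problems, and those with phi and psi exchanged, are solvable.    *)
(* Over K the forms phi and psi have the same subforms of dimension at most   *)
(* dim rho, and a Pfister form contained in a Pfister form is a factor of it. *)

(** * Quadratic maps and Witt extension *)

(** Let rho be the common (n-1)-fold factor and [r = 2 ^ (n-1)] its dimension, so that phi is
    [<1, a> rho] and psi is [<1, b> rho] ([factor_normal_form]); being non-hyperbolic, both are
    anisotropic ([isotropic_pfister]).

    An (m+1)-fold Pfister form with [m + 1 <= n - 1] has dimension at most r, and a Pfister form
    contained in an anisotropic Pfister form is a factor of it ([subform_factor], resting on
    [base_slot] and [slot]). It therefore suffices to find K over which phi and psi remain
    anisotropic and non-isometric and have the same subforms of dimension at most r.

    The invariant of the construction is [anis3]: phi, psi and [omega = <1, - a b> rho] are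
    anisotropic. Any two of the three have no common subform of dimension greater than r, because
    the third is anisotropic ([common_subform]). In particular phi and psi cannot become isometric.

    An isometry between subspaces of dimension less than r is extended by one vector over the
    function field of an affine quadric ([extension_step], [triple_step]). That field is reached by
    a rational function field ([generic_point]) followed by a quadratic extension
    ([quadratic_extension]). Loss of anisotropy there would descend, by [cassels_pfister], to a
    subform too large to exist, or would put the new vector in the old subspace by [witt_extension].

    Solving all these problems at once, including those with data in the new field, is done by an
    ultraproduct ([closure_field], [link_field]). Over the resulting field [embed_rows] copies
    subspaces of one form into the other, and [factor_transfer] turns this into equality of the sets
    of factors. *)

Section QuadraticMaps.
Variable R : comNzRingType.

Definition qmap N (A : 'M[R]_N) (v : 'rV_N) : R := (v *m A *m v^T) 0 0.
Definition pmap N (A : 'M[R]_N) (v w : 'rV_N) : R :=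
  (v *m (A + A^T) *m w^T) 0 0.

Variables (N : nat) (A : 'M[R]_N).
Implicit Types (u v w : 'rV[R]_N) (c : R).

Lemma qmapD v w : qmap A (v + w) = qmap A v + qmap A w + pmap A v w.
Proof.
have e : (w *m A *m v^T) 0 0 = (v *m A^T *m w^T) 0 0.
  have -> : v *m A^T *m w^T = (w *m A *m v^T)^T
    by rewrite !trmx_mul trmxK mulmxA.
  by rewrite [RHS]mxE.
rewrite /qmap /pmap raddfD /= !mulmxDl !mulmxDr !mulmxDl.
have mE (X Y : 'M[R]_1) : (X + Y) 0 0 = X 0 0 + Y 0 0 by rewrite mxE.
rewrite !mE e; ring.
Qed.

Lemma pmapE v w : pmap A v w = qmap A (v + w) - qmap A v - qmap A w.
Proof. rewrite qmapD; ring. Qed.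

Lemma qmapZ c v : qmap A (c *: v) = c ^+ 2 * qmap A v.
Proof. by rewrite /qmap [(c *: v)^T]linearZ /= -scalemxAl -!scalemxAr -scalemxAl
  !mxE mulrA. Qed.

Lemma qmap0 : qmap A 0 = 0.
Proof. by rewrite /qmap !mul0mx mxE. Qed.

Lemma qmapN v : qmap A (- v) = qmap A v.
Proof. by rewrite -scaleN1r qmapZ; ring. Qed.

Lemma pmapC v w : pmap A v w = pmap A w v.
Proof. by rewrite !pmapE [w + v]addrC addrAC. Qed.

Lemma pmapDr u v w : pmap A u (v + w) = pmap A u v + pmap A u w.
Proof. by rewrite /pmap [(v + w)^T]raddfD /= mulmxDr mxE. Qed.

Lemma pmapDl u v w : pmap A (u + v) w = pmap A u w + pmap A v w.
Proof. by rewrite /pmap !mulmxDl mxE. Qed.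

Lemma pmapZl c v w : pmap A (c *: v) w = c * pmap A v w.
Proof. by rewrite /pmap -!scalemxAl mxE. Qed.

Lemma pmapZr c v w : pmap A v (c *: w) = c * pmap A v w.
Proof. by rewrite pmapC pmapZl pmapC. Qed.

Lemma pmapNl v w : pmap A (- v) w = - pmap A v w.
Proof. by rewrite -scaleN1r pmapZl mulN1r. Qed.

Lemma pmapNr v w : pmap A v (- w) = - pmap A v w.
Proof. by rewrite pmapC pmapNl pmapC. Qed.

Lemma pmap0l w : pmap A 0 w = 0.
Proof. by rewrite /pmap !mul0mx mxE. Qed.

Lemma pmap0r w : pmap A w 0 = 0.
Proof. by rewrite pmapC pmap0l. Qed.

Lemma pmapvv v : pmap A v v = qmap A v *+ 2.
Proof. by rewrite pmapE -mulr2n -scaler_nat qmapZ; ring. Qed.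

Lemma qmapB v w : qmap A (v - w) = qmap A v + qmap A w - pmap A v w.
Proof. by rewrite qmapD qmapN pmapNr. Qed.

Lemma pmap_rows n p (X : 'M_(n, N)) (Y : 'M_(p, N)) i j :
  pmap A (row i X) (row j Y) = (X *m (A + A^T) *m Y^T) i j.
Proof.
rewrite /pmap -row_mul [LHS]mxE [RHS]mxE; apply: eq_bigr => k _.
by rewrite [row i _ _ _]mxE [(row j Y)^T _ _]mxE [Y^T _ _]mxE [row j Y _ _]mxE.
Qed.

End QuadraticMaps.

Lemma qmap_map (R S : comNzRingType) (f : {rmorphism R -> S}) N
    (A : 'M[R]_N) v : qmap (map_mx f A) (map_mx f v) = f (qmap A v).
Proof. by rewrite /qmap map_trmx -!map_mxM mxE. Qed.

Lemma pmap_map (R S : comNzRingType) (f : {rmorphism R -> S}) N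
    (A : 'M[R]_N) v w :
  pmap (map_mx f A) (map_mx f v) (map_mx f w) = f (pmap A v w).
Proof. by rewrite /pmap !map_trmx -map_mxD -!map_mxM mxE. Qed.

Definition anisotropic (K : fieldType) N (A : 'M[K]_N) : Prop :=
  forall v, qmap A v = 0 -> v = 0.

Definition nondegenerate (K : fieldType) N (A : 'M[K]_N) : bool :=
  A + A^T \in unitmx.

Lemma nondegenerateP (K : fieldType) N (A : 'M[K]_N) v :
  nondegenerate A -> (forall w, pmap A v w = 0) -> v = 0.
Proof.
move=> ndA h; have e : v *m (A + A^T) = 0.
  apply/rowP => j; rewrite [RHS]mxE.
  have := h (delta_mx 0 j); rewrite /pmap trmx_delta => <-.
  by rewrite -colE [RHS]mxE.
by rewrite -(mulmxK ndA v) e mul0mx.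
Qed.

(* Reflections: an anisotropic form admits Witt's extension theorem without   *)
(* any nondegeneracy assumption.                                              *)
Section Witt.
Variables (K : fieldType) (N : nat) (A : 'M[K]_N).

Definition refl (z : 'rV[K]_N) : 'M[K]_N :=
  1%:M - (qmap A z)^-1 *: ((A + A^T) *m z^T *m z).

Lemma reflE z v : v *m refl z = v - ((qmap A z)^-1 * pmap A v z) *: z.
Proof.
rewrite /refl mulmxBr mulmx1 -scalemxAr !mulmxA.
rewrite [_ *m _ *m z^T]mx11_scalar mul_scalar_mx scalerA.
by rewrite /pmap.
Qed.

Lemma refl_isom z v : qmap A z != 0 -> qmap A (v *m refl z) = qmap A v.
Proof. by move=> nz; rewrite reflE qmapB qmapZ pmapZr; field. Qed.

Lemma refl_id z v : pmap A v z = 0 -> v *m refl z = v.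
Proof. by move=> h; rewrite reflE h mulr0 scale0r subr0. Qed.

Lemma refl_swap v w : qmap A v = qmap A w -> qmap A (v - w) != 0 ->
  v *m refl (v - w) = w.
Proof.
move=> e nz; rewrite reflE.
have -> : pmap A v (v - w) = qmap A (v - w).
  by rewrite pmapDr pmapNr pmapvv qmapB -e mulr2n.
by rewrite mulVf // scale1r opprB addrC subrK.
Qed.

Lemma isom_pmap n m (B : 'M[K]_m) (Y : 'M[K]_(n, N)) (Z : 'M[K]_(n, m)) :
  (forall c, qmap A (c *m Y) = qmap B (c *m Z)) ->
  forall c d, pmap A (c *m Y) (d *m Y) = pmap B (c *m Z) (d *m Z).
Proof. by move=> h c d; rewrite !pmapE -!mulmxDl !h. Qed.

Lemma isom_pmap1 m (B : 'M[K]_m) (P : 'M[K]_(m, N)) :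
  (forall v, qmap A (v *m P) = qmap B v) ->
  forall v w, pmap A (v *m P) (w *m P) = pmap B v w.
Proof. by move=> h v w; rewrite !pmapE -!mulmxDl !h. Qed.

(** Induction on the rows. Once H carries Y' to Z', the vectors [y H] and z have equal values and
    equal products with Z', so the reflection in their difference carries one to the other and fixes
    Z'; anisotropy makes this reflection exist. The rows may be linearly dependent. *)
Lemma witt_extension n (Y Z : 'M[K]_(n, N)) : anisotropic A ->
    (forall c, qmap A (c *m Y) = qmap A (c *m Z)) ->
  exists H : 'M[K]_N, (forall v, qmap A (v *m H) = qmap A v) /\ Y *m H = Z.
Proof.
move=> anA; elim: n Y Z => [|n IH] Y Z h.
  exists 1%:M; split=> [v|]; first by rewrite mulmx1.
  by apply/matrixP; case.
have eY := vsubmxK (Y : 'M_(1 + n, N)); have eZ := vsubmxK (Z : 'M_(1 + n, N)).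
set y := usubmx _ in eY; set Y' := dsubmx _ in eY.
set z := usubmx _ in eZ; set Z' := dsubmx _ in eZ.
have hD (c : 'rV_1) (d : 'rV_n) :
    qmap A (c *m y + d *m Y') = qmap A (c *m z + d *m Z').
  by rewrite -!mul_row_col eY eZ.
have [d|H [isoH YH]] := IH Y' Z'.
  by have := hD 0 d; rewrite !mul0mx !add0r.
have qyz : qmap A (y *m H) = qmap A z.
  by have := hD 1%:M 0; rewrite !mul0mx !addr0 !mul1mx isoH.
have gl G : col_mx y Y' *m G = col_mx z Z' -> Y *m G = Z by rewrite eY eZ.
have [e|ne] := eqVneq (y *m H) z.
  by exists H; split=> //; apply: gl; rewrite mul_col_mx YH e.
have nz : qmap A (y *m H - z) != 0.
  by apply/eqP => /anA /eqP; rewrite subr_eq0 (negPf ne).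
exists (H *m refl (y *m H - z)); split=> [v|].
  by rewrite mulmxA refl_isom // isoH.
apply: gl; rewrite mul_col_mx !mulmxA refl_swap // YH; congr col_mx.
apply/row_matrixP => i; rewrite row_mul refl_id // pmapC pmapDl pmapNl.
apply/eqP; rewrite subr_eq0 !pmapE; apply/eqP.
have eZi : row i Z' = delta_mx 0 i *m Z' by rewrite rowE.
have eYi : row i Z' = delta_mx 0 i *m Y' *m H by rewrite eZi -YH mulmxA.
congr (_ - _ - _) => //.
rewrite {1}eYi -mulmxDl isoH -rowE eZi.
by have := hD 1%:M (delta_mx 0 i); rewrite !mul1mx -!rowE.
Qed.

End Witt.

(** * The Cassels-Pfister theorem *)

Section PolynomialPoints.
Variables (K : fieldType) (N : nat) (A : 'M[K]_N).
Local Notation AP := (map_mx polyC A).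
Implicit Type p : 'rV[{poly K}]_N.

Lemma coefM_top (p q : {poly K}) m n : (size p <= m.+1)%N ->
  (size q <= n.+1)%N ->
  (p * q)`_(m + n) = p`_m * q`_n.
Proof.
move=> sp sq; have lt_m : (m < (m + n).+1)%N by rewrite ltnS leq_addr.
rewrite coefM (bigD1 (Ordinal lt_m)) //= addKn big1 ?addr0 // => i ne_im.
have [lt_im|] := ltnP i m.
  rewrite [q`__]nth_default ?mulr0 // (leq_trans sq) //.
  by rewrite ltn_subRL ltn_add2r.
rewrite leq_eqVlt => /predU1P[e|lt_mi]; last
  by rewrite nth_default ?mul0r // (leq_trans sp).
by case/eqP: ne_im; apply: val_inj.
Qed.

Lemma size_vec_mulC k m (p : 'rV[{poly K}]_N) (C : 'M[K]_(N, k)) j :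
  (forall i, size (p 0%R i) <= m)%N ->
    (size ((p *m map_mx polyC C) 0%R j) <= m)%N.
Proof.
move=> sp; rewrite mxE (leq_trans (size_sum _ _ _)) //.
apply/bigmax_leqP => i _; rewrite mxE mulrC mul_polyC.
exact: leq_trans (size_scale_leq _ _) (sp i).
Qed.

Lemma coef_vec_mulC k m (p : 'rV[{poly K}]_N) (C : 'M[K]_(N, k)) :
  map_mx (coefp m) (p *m map_mx polyC C) = map_mx (coefp m) p *m C.
Proof.
apply/rowP => j; rewrite !mxE /= coef_sum; apply: eq_bigr => i _.
by rewrite !mxE /= coefMC.
Qed.

Lemma qmap_sum (R : comNzRingType) (B : 'M[R]_N) v :
  qmap B v = \sum_j (v *m B) 0 j * v 0 j.
Proof. by rewrite /qmap mxE; apply: eq_bigr => j _; rewrite [v^T _ _]mxE. Qed.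

Lemma size_qmap p m : (forall i, size (p 0%R i) <= m.+1)%N ->
  (size (qmap AP p) <= (m + m).+1)%N.
Proof.
move=> sp; rewrite qmap_sum (leq_trans (size_sum _ _ _)) //.
apply/bigmax_leqP => i _; apply: leq_trans (size_polyMleq _ _) _.
have := leq_add (size_vec_mulC A i sp) (sp i); rewrite addSn addnS.
by case: (_ + _)%N.
Qed.

Lemma coef_qmap p m : (forall i, size (p 0%R i) <= m.+1)%N ->
  (qmap AP p)`_(m + m) = qmap A (map_mx (coefp m) p).
Proof.
move=> sp; rewrite qmap_sum coef_sum qmap_sum; apply: eq_bigr => j _.
by rewrite coefM_top ?size_vec_mulC // -coef_vec_mulC !mxE.
Qed.

Hypothesis anA : anisotropic A.

(** Top degrees cannot cancel: the vector of coefficients in the top degree has a nonzero value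
    under an anisotropic form. *)
Lemma size_vecP p e : (size (qmap AP p) <= (e + e).+1)%N ->
  forall i, (size (p 0%R i) <= e.+1)%N.
Proof.
move=> sq; pose m := (\max_i size (p 0%R i))%N.
have : (forall i, size (p 0%R i) <= m)%N by move=> i; apply: leq_bigmax.
elim: m => [|m IH] sp i; first exact: leq_trans (sp i) _.
have [le_me|lt_em] := leqP m e; first exact: leq_trans (sp i) _.
apply: IH => {}i; apply/leq_sizeP => j; rewrite leq_eqVlt => /predU1P[<-|lt_mj].
  have : qmap A (map_mx (coefp m) p) = 0.
    rewrite -coef_qmap // nth_default // (leq_trans sq) //.
    by rewrite -addnS leq_add // ltnW.
  by move/anA/rowP/(_ i); rewrite !mxE.
by rewrite nth_default // (leq_trans (sp i)).
Qed.

Lemma qmap_poly_eq0 p : qmap AP p = 0 -> p = 0.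
Proof.
move=> q0; apply/rowP => i; rewrite [RHS]mxE; apply/eqP; rewrite -size_poly_eq0.
pose m := (\max_i size (p 0%R i))%N.
suff : forall m', (forall i, size (p 0%R i) <= m')%N -> (size (p 0%R i) <= 0)%N.
  by move/(_ m)=> h; rewrite -leqn0 h // => j; apply: leq_bigmax.
elim=> [|{}m IH] sp; first exact: sp.
apply: IH => {}i; apply/leq_sizeP => j; rewrite leq_eqVlt => /predU1P[<-|lt_mj].
  have : qmap A (map_mx (coefp m) p) = 0 by rewrite -coef_qmap // q0 coef0.
  by move/anA/rowP/(_ i); rewrite !mxE.
by rewrite nth_default // (leq_trans (sp i)).
Qed.

(* Cassels-Pfister: if d is a common denominator of a point of the quadric    *)
(* and r the remainder of its numerator mod d, then the second intersection   *)
(* of the quadric with the line through the point and its polynomial part has *)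
(* denominator Q(r) / d, of smaller degree; linear constraints are preserved  *)
(* because r satisfies the homogeneous ones for degree reasons.               *)
Lemma cassels_pfister k (C : 'M[K]_(N, k)) f (l : 'rV_k) d p :
    d != 0 -> qmap AP p = d ^+ 2 * f -> p *m map_mx polyC C = d *: l ->
  exists p', qmap AP p' = f /\ p' *m map_mx polyC C = l.
Proof.
have [n] := ubnP (size d); elim: n d p => // n IH d p lt_dn nz_d qp lp.
pose z := map_mx (fun x => x %/ d) p; pose r := map_mx (fun x => x %% d) p.
have Dp : p = d *: z + r by apply/rowP => i; rewrite !mxE mulrC -divp_eq.
have sr i : (size (r 0%R i) < size d)%N by rewrite mxE ltn_modpN0.
have [lz lr] : z *m map_mx polyC C = l /\ r *m map_mx polyC C = 0.
  have e : r *m map_mx polyC C = d *: (l - z *m map_mx polyC C).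
    by rewrite scalerBr -lp Dp mulmxDl scalemxAl addrC addKr.
  have z0 : l - z *m map_mx polyC C = 0.
    apply/rowP => j; rewrite [RHS]mxE; apply/eqP/negPn/negP => nz.
    have /rowP/(_ j) := e; rewrite [RHS]mxE => ej.
    have : (size ((r *m map_mx polyC C) 0%R j) <= (size d).-1)%N.
      by apply: size_vec_mulC => i; rewrite -ltnS prednK ?size_poly_gt0.
    by rewrite ej size_mul // (polySpred nz) (polySpred nz_d) addSn addnS /=
      ltnNge leq_addr.
  by split; [apply/eqP; rewrite eq_sym -subr_eq0 z0 | rewrite e z0 scaler0].
have [r0|nz_r] := eqVneq r 0.
  exists z; split=> //; apply: (mulfI (expf_neq0 2 nz_d)).
  by rewrite -qp Dp r0 addr0 qmapZ.
pose d' := d * f - pmap AP z p + d * qmap AP z.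
have Dr : r = p - d *: z by rewrite Dp addrC addKr.
have qr : qmap AP r = d * d'.
  by rewrite Dr qmapB qmapZ pmapZr qp pmapC /d'; ring.
have nz_qr : qmap AP r != 0 by apply: contraNneq nz_r => /qmap_poly_eq0 ->.
have nz_d' : d' != 0 by apply: contraNneq nz_qr; rewrite qr => ->;
  rewrite mulr0.
have lt_d'd : (size d' < size d)%N.
  have [e|] := posnP (size d).-1.
    case/eqP: nz_r; apply/rowP => i; rewrite [RHS]mxE; apply/eqP.
    by have := sr i; rewrite -size_poly_leq0 (polySpred nz_d) e.
  case e: (size d).-1 => [//|m] _.
  have : (size (qmap AP r) <= (m + m).+1)%N.
    by apply: size_qmap => i; rewrite -ltnS -e prednK ?size_poly_gt0.
  rewrite qr size_mul // (polySpred nz_d) e addSn /= !addSn addnC !ltnS => h.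
  by rewrite -(leq_add2r m) (leq_trans h) ?leq_add2r // leq_addr.
(* On the line [z + t r] the equation [Q = f] has the root [1 / d] and, from the product of the
   roots, the root [(Q(z) - f) / d']. The new numerator is d' times this second point. *)
apply: (IH d' (d' *: z + (qmap AP z - f) *: r)) => //.
- by rewrite (leq_trans lt_d'd).
- have -> : qmap AP (d' *: z + (qmap AP z - f) *: r) =
      d' ^+ 2 * qmap AP z + (qmap AP z - f) * (d' * pmap AP z r
         + (qmap AP z - f) * (d * d')).
    by rewrite qmapD !qmapZ pmapZl pmapZr qr; ring.
  have -> : pmap AP z r = pmap AP z p - d * qmap AP z *+ 2.
    by rewrite Dr pmapDr pmapNr pmapZr pmapvv; ring.
  rewrite /d'; ring.
- by rewrite mulmxDl -!scalemxAl lz lr scaler0 addr0.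
Qed.

End PolynomialPoints.

(** * Points over rational function fields *)

Local Notation "x %:F" := (@FracField.tofrac _ x).


Lemma map_mx_injective (aT rT : Type) (f : aT -> rT) m n :
  injective f -> injective (map_mx f : 'M_(m, n) -> 'M_(m, n)).
Proof.
by move=> inj_f X Y e; apply/matrixP => i j; move/matrixP/(_ i j): e;
  rewrite !mxE => /inj_f.
Qed.

Lemma frac_denom (R : idomainType) (x : {fraction R}) :
  exists d n : R, d != 0 /\ d%:F * x = n%:F.
Proof.
have: exists y : {ratio R}, x = (\pi_({fraction R}) y)%qT by exists (repr x);
  rewrite reprK.
case=> y ->; exists (frac y).2, (frac y).1; split; first exact: denom_ratioP.
unlock FracField.tofrac; rewrite -[LHS]FracField.pi_mul; apply/eqP.
rewrite piE /equivf /FracField.mulf /=.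
by rewrite !numden_Ratio ?(oner_neq0, mul1r, mulr1, denom_ratioP) // mulrC.
Qed.

Lemma vec_denom (R : idomainType) N (y : 'rV[{fraction R}]_N) :
  exists (d : R) (p : 'rV[R]_N),
    d != 0 /\ d%:F *: y = map_mx (@FracField.tofrac R) p.
Proof.
elim: N y => [|N IH] y.
  by exists 1, 0; rewrite oner_neq0; split=> //; apply/rowP; case.
move: y; rewrite -[N.+1]/(1 + N)%N => y.
rewrite -[y]hsubmxK; set x := lsubmx _; set z := rsubmx _.
have [d [p [nz_d Dp]]] := IH z; have [d' [q [nz_d' Dq]]] := frac_denom (x 0 0).
exists (d' * d), (row_mx (d * q)%:M (d' *: p)); split; first
  by rewrite mulf_neq0.
rewrite scale_row_mx map_row_mx map_mxZ -Dp /= tofracM scalerA map_scalar_mx /=.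
congr row_mx; rewrite [x]mx11_scalar scale_scalar_mx tofracM -Dq; congr _%:M;
  ring.
Qed.

Section FractionPoints.
Variable K : fieldType.
Let T : fieldType := {fraction {poly K}}.

Definition frac_const : {rmorphism K -> T} :=
  (@FracField.tofrac {poly K}) \o polyC.

Lemma map_frac_const m n (A : 'M[K]_(m, n)) :
  map_mx frac_const A = map_mx (@FracField.tofrac {poly K}) (map_mx polyC A).
Proof. by rewrite -map_mx_comp. Qed.

Variables (N : nat) (A : 'M[K]_N).
Hypothesis anA : anisotropic A.

Lemma frac_anisotropic : anisotropic (map_mx frac_const A).
Proof.
move=> y q0; have [d [p [nz_d Dp]]] := vec_denom y.
have : qmap (map_mx frac_const A) (d%:F *: y) = 0 by rewrite qmapZ q0 mulr0.
rewrite Dp map_frac_const qmap_map => /eqP; rewrite tofrac_eq0.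
move=> /eqP /(qmap_poly_eq0 anA) p0; move: Dp.
rewrite p0 map_mx0 => /eqP; rewrite scaler_eq0 tofrac_eq0 (negPf nz_d).
by move/eqP.
Qed.

Lemma frac_point k (C : 'M[K]_(N, k)) y (f : {poly K}) l :
    qmap (map_mx frac_const A) y = f%:F ->
    y *m map_mx frac_const C = map_mx (@FracField.tofrac {poly K}) l ->
  exists p, qmap (map_mx polyC A) p = f /\ p *m map_mx polyC C = l.
Proof.
move=> qy ly; have [d [p [nz_d Dp]]] := vec_denom y.
apply: (cassels_pfister anA nz_d (p := p)).
  apply/eqP; rewrite -tofrac_eq -qmap_map -map_frac_const -Dp qmapZ qy.
  by rewrite tofracM tofracXn.
apply: (map_mx_injective (f := @FracField.tofrac {poly K})).
  by move=> ? ? /eqP; rewrite tofrac_eq => /eqP.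
by rewrite map_mxM -map_frac_const -Dp map_mxZ -ly scalemxAl.
Qed.

Lemma polyC_inj_mx m n : injective (map_mx polyC : 'M[K]_(m, n) -> _).
Proof. exact/map_mx_injective/polyC_inj. Qed.

Lemma frac_point_const k (C : 'M[K]_(N, k)) y f l :
    qmap (map_mx frac_const A) y = frac_const f ->
    y *m map_mx frac_const C = map_mx frac_const l ->
  exists u, qmap A u = f /\ u *m C = l.
Proof.
rewrite [map_mx _ l]map_frac_const => qy ly.
have [p [qp lp]] := @frac_point k C y f%:P (map_mx polyC l) qy ly.
have sp := @size_vecP _ _ _ anA p 0.
have Dp : p = map_mx polyC (map_mx (coefp 0) p).
  apply/rowP => i; rewrite !mxE; apply: size1_polyC; apply: sp.
  by rewrite qp size_polyC_leq1.
exists (map_mx (coefp 0) p); split.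
  by apply: polyC_inj; rewrite -qmap_map -Dp.
by apply: polyC_inj_mx; rewrite map_mxM -Dp.
Qed.

Lemma quad_poly_inj (a b c a' b' c' : K) :
    a%:P + 'X * b%:P + 'X ^+ 2 * c%:P = a'%:P + 'X * b'%:P + 'X ^+ 2 * c'%:P ->
  [/\ a = a', b = b' & c = c'].
Proof.
move=> e; have co i := congr1 (fun q : {poly K} => q`_i) e.
have := (co 0%N, co 1%N, co 2%N).
rewrite !coefD !coefXM !coefXnM !coefC /= !(addr0, add0r).
by case=> [[]].
Qed.

(** The point may be taken polynomial, and then of degree at most 1 because its value has degree at
    most 2; the conclusions are the comparison of coefficients. *)
Lemma frac_point_lin k (C : 'M[K]_(N, k)) y f0 f1 f2 l0 l1 :
    qmap (map_mx frac_const A) y =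
      (f0%:P + 'X * f1%:P + 'X ^+ 2 * f2%:P)%:F ->
    y *m map_mx frac_const C =
      map_mx frac_const l0 + 'X%:F *: map_mx frac_const l1 ->
  exists y0 y1, [/\ qmap A y0 = f0, pmap A y0 y1 = f1, qmap A y1 = f2,
    y0 *m C = l0 & y1 *m C = l1].
Proof.
move=> qy; rewrite !(map_frac_const l0, map_frac_const l1) -map_mxZ -map_mxD.
move=> /(frac_point qy) [p [qp lp]].
have sp : forall i, (size (p 0%R i) <= 2)%N.
  apply: (size_vecP anA (e := 1)); rewrite qp.
  rewrite -addrA (leq_trans (size_polyD _ _)) // geq_max size_polyC
    (leq_trans (leq_b1 _)) //=.
  rewrite (leq_trans (size_polyD _ _)) // geq_max; apply/andP; split.
    by rewrite mulrC mul_polyC (leq_trans (size_scale_leq _ _)) // size_polyX.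
  by rewrite mulrC mul_polyC (leq_trans (size_scale_leq _ _)) // size_polyXn.
pose y0 := map_mx (coefp 0) p; pose y1 := map_mx (coefp 1) p.
have Dp : p = map_mx polyC y0 + 'X *: map_mx polyC y1.
  apply/rowP => i; rewrite !mxE; apply/polyP => -[|[|j]];
    rewrite coefD coefXM !coefC /= ?addr0 ?add0r //.
  by rewrite (leq_sizeP _ _ (sp i)).
exists y0, y1; move: qp lp; rewrite Dp qmapD qmapZ pmapZr !qmap_map pmap_map.
rewrite addrAC => /quad_poly_inj[-> -> ->];
  rewrite mulmxDl -scalemxAl -!map_mxM.
move=> e; suff: y0 *m C = l0 /\ y1 *m C = l1 by case.
move: (y0 *m C) (y1 *m C) e => u v /rowP e; split; apply/rowP => j.
  have /(congr1 (coefp 0)) := e j.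
  by rewrite !mxE /= !coefD !coefXM !coefC /= !addr0.
have /(congr1 (coefp 1)) := e j.
by rewrite !mxE /= !coefD !coefXM !coefC /= !add0r.
Qed.

End FractionPoints.

(* The field M is K(t_1, ..., t_n), w = w0 + t_1 E_1 + ... + t_n E_n.         *)
Lemma generic_point (K : fieldType) D n (w0 : 'rV[K]_D) (E : 'M[K]_(n, D)) :
  exists (M : fieldType) (i : {rmorphism K -> M}) (t : 'rV[M]_n),
  let w := map_mx i w0 + t *m map_mx i E in
  [/\ forall N (A : 'M[K]_N), anisotropic A -> anisotropic (map_mx i A),
      forall N k (A : 'M[K]_N) (C : 'M[K]_(N, k)) y f l, anisotropic A ->
        qmap (map_mx i A) y = i f -> y *m map_mx i C = map_mx i l ->
        exists u, qmap A u = f /\ u *m C = l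
    & forall N k (A : 'M[K]_N) (G : 'M[K]_D) (C : 'M[K]_(N, k)) (L :
      'M_(D, k)) y,
        anisotropic A -> qmap (map_mx i A) y = qmap (map_mx i G) w ->
        y *m map_mx i C = w *m map_mx i L ->
        exists y0 Y, forall z c,
          qmap A (z *: y0 + c *m Y) = qmap G (z *: w0 + c *m E) /\
          (z *: y0 + c *m Y) *m C = (z *: w0 + c *m E) *m L].
Proof.
elim: n E => [|n IH] E.
  exists K, idfun, 0; split=> [N A|N k A C y f l|N k A G C L y] anA.
  - by rewrite map_mx_id.
  - by rewrite !map_mx_id //; exists y.
  rewrite !map_mx_id // mul0mx addr0 => qy Cy; exists y, 0 => z c.
  rewrite !mulmx0 [E]flatmx0 mulmx0 !addr0 !qmapZ qy -!scalemxAl Cy.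
  by split.
move: E; rewrite -[n.+1]/(1 + n)%N => E; rewrite -[E]vsubmxK.
set e := usubmx E; set E' := dsubmx E.
have [M' [i [t' [anM' ptM' linM']]]] := IH E'.
set w' := map_mx i w0 + _ in linM'; set j := @frac_const M'.
pose T : fieldType := {fraction {poly M'}}.
pose x : T := @FracField.tofrac _ 'X.
pose h : {rmorphism K -> T} := j \o i.
have hE m1 m2 (X : 'M[K]_(m1, m2)) : map_mx h X = map_mx j (map_mx i X).
  by rewrite -map_mx_comp.
exists T, h, (row_mx x%:M (map_mx j t')).
rewrite map_col_mx mul_row_col !hE -map_mxM addrCA -map_mxD -/w' mul_scalar_mx.
set w := x *: _ + _; rewrite /=.
have an N (A : 'M[K]_N) : anisotropic A -> anisotropic (map_mx h A).
  by move=> /anM' anA; rewrite hE; apply: frac_anisotropic.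
have pt N k (A : 'M[K]_N) (C : 'M[K]_(N, k)) y f l : anisotropic A ->
        qmap (map_mx h A) y = h f -> y *m map_mx h C = map_mx h l ->
        exists u, qmap A u = f /\ u *m C = l.
  move=> anA; rewrite !hE => qy ly.
  have [u [qu lu]] := frac_point_const (anM' _ _ anA) qy ly.
  exact: ptM' anA qu lu.
split=> // N k A G C L y anA qy Cy.
have qG : qmap (map_mx h G) w = @FracField.tofrac _
    ((qmap (map_mx i G) w')%:P + 'X * (pmap (map_mx i G) w' (map_mx i e))%:P
      + 'X ^+ 2 * (i (qmap G e))%:P).
  rewrite hE /w qmapD qmapZ pmapZl !qmap_map pmap_map pmapC.
  rewrite !tofracD !tofracM expr2. ring.
have lG : w *m map_mx h L = map_mx j (w' *m map_mx i L) +
    x *: map_mx j (map_mx i e *m map_mx i L).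
  by rewrite /w mulmxDl -scalemxAl !hE -!map_mxM addrC.
rewrite qG hE in qy; rewrite lG hE in Cy.
have [y0 [y1 [q0 p01 q1 l0 l1]]] := frac_point_lin (anM' _ _ anA) qy Cy.
(* The value of y1 is constant, so some u over K has the same value and the same constraints. The
   reflection carrying y1 to u is applied to y0 as well; it respects the constraints because
   [z C = 0]. *)
have [|u [qu Cu]] := ptM' _ _ A C y1 (qmap G e) (e *m L) anA q1.
  by rewrite l1 -map_mxM.
pose z := y1 - map_mx i u.
have Cz : z *m map_mx i C = 0 by rewrite mulmxBl l1 -!map_mxM -Cu subrr.
have [y0' [q0' p0' C0']] :
  exists y0', [/\ qmap (map_mx i A) y0' = qmap (map_mx i G) w',
    pmap (map_mx i A) y0' (map_mx i u) = pmap (map_mx i G) w' (map_mx i e)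
    & y0' *m map_mx i C = w' *m map_mx i L].
  have [z0|nz_z] := eqVneq z 0.
    by exists y0; move/eqP: z0; rewrite subr_eq0 => /eqP <-.
  have nz_q : qmap (map_mx i A) z != 0.
    by apply/eqP => /(anM' _ _ anA)/eqP; rewrite (negPf nz_z).
  exists (y0 *m refl (map_mx i A) z); split.
  - by rewrite refl_isom.
  - have <- : y1 *m refl (map_mx i A) z = map_mx i u.
      by rewrite refl_swap // qmap_map qu.
    rewrite pmapE -mulmxDl !refl_isom // -p01 pmapE; ring.
  - by rewrite reflE mulmxBl -scalemxAl Cz scaler0 subr0.
(* The polar condition between y0' and u is linear in y0' with coefficients in K, so it goes to the
   induction hypothesis as one more column of constraints. This is the reason for carrying C and
   L. *)
pose C2 := row_mx C ((A + A^T) *m u^T); pose L2 := row_mx L ((G + G^T) *m e^T).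
have [|a [Y' aY']] := linM' N _ A G C2 L2 y0' anA q0'.
  rewrite !map_row_mx !mul_mx_row C0'; congr row_mx.
  apply/rowP => s; rewrite ord1.
  by have := p0'; rewrite /pmap !map_mxM !map_mxD !map_trmx !mulmxA.
exists a, (col_mx u Y') => s c; rewrite -[c](@hsubmxK _ _ 1 n).
set d := lsubmx c; set c' := rsubmx c; rewrite !mul_row_col.
have [qs] := aY' s c'; rewrite !mul_mx_row => /eq_row_mx[Cs ps].
rewrite ![_ *: _ + (_ + _)]addrCA; split; last first.
  by rewrite mulmxDl -(mulmxA d) Cu Cs mulmxA -mulmxDl.
rewrite [d]mx11_scalar !mul_scalar_mx qmapD [RHS]qmapD !(qmapZ _ (d 0 0)) qs qu
  !pmapZl.
congr (_ + _ + _ * _); rewrite pmapC [RHS]pmapC /pmap.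
by move/matrixP/(_ 0 0): ps; rewrite !mulmxA.
Qed.

(** * Quadratic extensions *)

Definition similar (K : fieldType) N (A : 'M[K]_N) c : Prop :=
  exists S : 'M_N, forall v, qmap A (v *m S) = c * qmap A v.

Definition round (K : fieldType) N (A : 'M[K]_N) : Prop :=
  forall v, qmap A v != 0 -> similar A (qmap A v).

Lemma similarV (K : fieldType) N (A : 'M[K]_N) c :
  c != 0 -> similar A c -> similar A c^-1.
Proof.
by move=> nz_c [S hS]; exists (c^-1 *: S) => v; rewrite -scalemxAr qmapZ hS;
  field.
Qed.

Lemma similarM (K : fieldType) N (A : 'M[K]_N) c d :
  similar A c -> similar A d -> similar A (c * d).
Proof.
by move=> [S hS] [T hT]; exists (S *m T) => v; rewrite mulmxA hT hS; ring.
Qed.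

(** Let [y0 + z y1] be an isotropic vector over the root field. Reduction modulo the minimal
    polynomial gives [al A(y0) = ga A(y1)], and if y1 is nonzero, roundness makes
    [al ^ 2 A(y0) / A(y1) = al ga] a value of A over M. *)
Lemma quadratic_extension (M : fieldType) (al be ga : M) : al != 0 ->
  (exists x, al * x ^+ 2 + be * x + ga = 0) \/
  exists (L : fieldType) (i : {rmorphism M -> L}) (x : L),
    i al * x ^+ 2 + i be * x + i ga = 0 /\
    forall N (A : 'M[M]_N), anisotropic A -> round A ->
      (forall y, qmap A y <> al * ga) -> anisotropic (map_mx i A).
Proof.
move=> nz_al;
  have [|noroot] := boolp.EM (exists x, al * x ^+ 2 + be * x + ga = 0).
  by left.
right; pose p := Poly [:: ga; be; al].
have Dp : p = ga%:P + be *: 'X + al *: 'X^2.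
  apply/polyP => k; rewrite coef_Poly !coefD coefC !coefZ coefX coefXn.
  by case: k => [|[|[|k]]]; rewrite /= ?nth_nil ?mulr0 ?mulr1 ?add0r ?addr0.
have sp : size p = 3.
  by rewrite (@PolyK _ 0) //=.
have irp : irreducible_poly p.
  apply: cubic_irreducible => [|x]; first by rewrite sp.
  apply/negP => /rootP; rewrite Dp => e; case: noroot; exists x.
  by rewrite -e !(hornerD, hornerZ, hornerXn, hornerX, hornerC); ring.
have [L dimL [z pz genz]] := irredp_FAdjoin irp.
pose i : {rmorphism M -> L} := in_alg L.
exists L, i, z.
have ez : i al * z ^+ 2 + i be * z + i ga = 0.
  move/rootP: pz;
    rewrite Dp !rmorphD /= !map_polyZ map_polyC map_polyX map_polyXn /=.
  by rewrite !(hornerD, hornerZ, hornerXn, hornerX, hornerC) => <-; ring.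
split=> // N A anA rdA noval Y qY.
have indep (a b : M) : i a + i b * z = 0 -> a = 0 /\ b = 0.
  move=> e; have [b0|nz_b] := eqVneq b 0.
    by split=> //; move: e; rewrite b0 rmorph0 mul0r addr0 => /eqP;
      rewrite fmorph_eq0 => /eqP.
  have nzib : i b != 0 by rewrite fmorph_eq0.
  have Dz : z = i (- a / b).
    rewrite fmorph_div rmorphN; apply: (mulIf nzib).
    by rewrite mulfVK // mulrC -[RHS]addr0 -e addKr.
  case: noroot; exists (- a / b); move: (- a / b) Dz => r Dz.
  by apply: (fmorph_inj i); rewrite expr2 !rmorphD !rmorphM rmorph0 -Dz -expr2.
have dec y : exists ab : M * M, y = i ab.1 + i ab.2 * z.
  have yz : y \in <<1; z>>%VS by rewrite genz memvf.
  pose q := Fadjoin_poly 1%AS z y.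
  have /polyOverP qo : q \is a polyOver 1%AS by apply: Fadjoin_polyOver.
  have sq : (size q <= 2)%N.
    have := size_Fadjoin_poly 1%AS z y.
    by rewrite /adjoin_degree -/q genz dimL sp dimv1 divn1.
  have [[a qa] [b qb]] := (vlineP _ _ (qo 0%N), vlineP _ _ (qo 1%N)).
  exists (a, b); rewrite -[LHS](Fadjoin_poly_eq yz) -/q (horner_coef_wide _ sq).
  by rewrite !big_ord_recl big_ord0 /= qa qb expr0 expr1 mulr1 addr0.
have [f Yf] := fin_all_exists (fun j => dec (Y 0 j)).
pose y0 := \row_j (f j).1; pose y1 := \row_j (f j).2.
have DY : Y = map_mx i y0 + z *: map_mx i y1.
  by apply/rowP => j; rewrite !mxE Yf mulrC.
have [e0 e1] : al * qmap A y0 - ga * qmap A y1 = 0 /\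
  al * pmap A y0 y1 - be * qmap A y1 = 0.
  apply: indep; transitivity (i al * qmap (map_mx i A) Y -
      i (qmap A y1) * (i al * z ^+ 2 + i be * z + i ga)).
    rewrite DY qmapD qmapZ pmapZr !qmap_map pmap_map !rmorphB !rmorphM /=; ring.
  by rewrite qY ez !mulr0 subr0.
have [q10|nz_q1] := eqVneq (qmap A y1) 0.
  have y10 := anA _ q10; have: qmap A y0 = 0.
    by apply: (mulfI nz_al); move: e0; rewrite q10 !mulr0 subr0.
  by move/anA => y00; rewrite DY y00 y10 !map_mx0 scaler0 addr0.
have [S hS] := similarV nz_q1 (rdA _ nz_q1).
case: (noval (al *: (y0 *m S))); rewrite qmapZ hS.
move/eqP: e0; rewrite subr_eq0 => /eqP e0.
have -> : al ^+ 2 * ((qmap A y1)^-1 * qmap A y0) =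
  al * (al * qmap A y0) / qmap A y1 by ring.
by rewrite e0; field.
Qed.

(** * Extending an isometry over a larger field *)

Section ExtensionStep.
Variables (L : fieldType) (N k r : nat) (A G : 'M[L]_N) (T V : 'M[L]_(k, N)).
Variables (y : 'rV[L]_N) (XX : 'M[L]_N -> Prop).

(** Roundness is used over the rational function field of the quadric, hence is demanded over every
    extension. *)
Definition abs_round (X : 'M[L]_N) :=
  forall (M : fieldType) (i : {rmorphism L -> M}), round (map_mx i X).

Hypotheses (lt_kr : (k + r < N)%N) (anA : anisotropic A) (anG : anisotropic G).
Hypotheses (ndG : nondegenerate G) (rdG : abs_round G).
Hypothesis anX : forall X, XX X -> anisotropic X.
Hypothesis rdX : forall X, XX X -> abs_round X.
Hypothesis subX : forall X, XX X -> forall n (D g : 'M_(n, N)),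
  (forall c, qmap G (c *m D) = qmap X (c *m g)) -> (\rank D <= r)%N.
Hypothesis isoTV : forall c, qmap A (c *m T) = qmap G (c *m V).

Let Xi : 'M_(N, k) := (G + G^T) *m V^T.
Let rhs := y *m (A + A^T) *m T^T.
Let E := kermx Xi.

Lemma rank_ker : (r < \rank E)%N.
Proof. by rewrite mxrank_ker ltn_subRL (leq_ltn_trans _ lt_kr) // leq_add2r
  rank_leq_col. Qed.

(** The system is consistent because a relation among the rows of V is one among the rows of T: if
    [c V = 0] then [A(c T) = 0], and A is anisotropic. *)
Lemma affine_sol : exists w0, w0 *m Xi = rhs.
Proof.
suff /submxP[w0 ->] : (rhs <= Xi)%MS by exists w0.
rewrite submxE; apply/eqP; rewrite /rhs -mulmxA; set C := cokermx _.
have VC : V^T *m C = 0.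
  have ndG' : G + G^T \in unitmx := ndG.
  by rewrite -[V^T](mulKmx ndG') -mulmxA /C mulmx_coker mulmx0.
suff -> : T^T *m C = 0 by rewrite mulmx0.
apply: trmx_inj; apply/row_matrixP => i.
rewrite trmx_mul !trmxK trmx0 row0 row_mul; apply: anA.
by rewrite isoTV -row_mul -[V]trmxK -trmx_mul VC trmx0 row0 qmap0.
Qed.

Lemma ker_perp (v : 'rV_N) : v *m (G + G^T) *m E^T = 0 -> exists c, v = c *m V.
Proof.
have ndG' : G + G^T \in unitmx := ndG.
have symG : (G + G^T)^T = G + G^T by rewrite raddfD /= trmxK addrC.
move=> h; have: (v *m (G + G^T) <= Xi^T)%MS.
  rewrite submxE; set C := cokermx _.
  have : (C^T <= E)%MS.
    by apply/sub_kermxP; rewrite -[Xi]trmxK -trmx_mul mulmx_coker trmx0.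
  case/submxP=> D /(congr1 trmx); rewrite trmxK trmx_mul => ->.
  by rewrite mulmxA h mul0mx.
case/submxP => c; rewrite /Xi trmx_mul trmxK symG mulmxA => e.
by exists c; rewrite -(mulmxK ndG' v) e mulmxK.
Qed.

(** Unless y lies in the span of T, take a generic solution w of the linear conditions and a nonzero
    u in their kernel E. Then [G(w + x u) = A(y)] is a quadratic equation in x with coefficients al,
    be, ga, and by [quadratic_extension] only a representation of [al ga] can destroy anisotropy. *)
Lemma extension_step :
  exists (M : fieldType) (i : {rmorphism L -> M}) (w : 'rV[M]_N),
    [/\ anisotropic (map_mx i G), forall X : 'M_N, XX X ->
      anisotropic (map_mx i X),
        qmap (map_mx i G) w = i (qmap A y)
      & w *m map_mx i Xi = map_mx i rhs].
Proof.
have [[c Dy]|nspan] := boolp.EM (exists c, y = c *m T).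
  exists L, idfun, (c *m V); rewrite !map_mx_id //; split=> //.
  - by move=> X XX_X; rewrite map_mx_id //; apply: anX.
  - by rewrite Dy isoTV.
  - rewrite /Xi /rhs Dy mulmxA; apply/rowP => j.
    have := isom_pmap isoTV c (delta_mx 0 j).
    rewrite /pmap !trmx_mul !trmx_delta !mulmxA -!colE.
    by rewrite !mxE => ->.
have [w0 Dw0] := affine_sol.
have EX : E *m Xi = 0 by apply: mulmx_ker.
have [s nz_u] : exists s, row s E != 0.
  apply/existsP; rewrite -negb_forall; apply/negP => /forallP h.
  have E0 : E = 0 by apply/row_matrixP => s; rewrite row0; apply/eqP.
  by have := rank_ker; rewrite E0 mxrank0.
set u := row s E in nz_u; set al := qmap G u.
have nz_al : al != 0 by apply: contraNneq nz_u => /anG ->.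
have uX : u *m Xi = 0 by rewrite -row_mul EX row0.
set c0 := qmap A y.
(* The constant c0 is homogenized: with an additional coordinate, equal to 1 at the generic point,
   [al * ga] becomes the value of a quadratic form, to which [generic_point] applies. *)
pose G' := block_mx (al *: G) 0 0 (- (al * c0))%:M : 'M_(N + 1).
have qG' (M : fieldType) (i : {rmorphism L -> M}) v z :
    qmap (map_mx i G') (row_mx v z%:M) =
      i al * (qmap (map_mx i G) v - i c0 * z ^+ 2).
  rewrite map_block_mx !map_mx0 map_scalar_mx map_mxZ /qmap mul_row_block.
  rewrite !mulmx0 addr0 add0r tr_row_mx mul_row_col tr_scalar_mx -!scalar_mxM.
  rewrite -scalemxAr -scalemxAl (rmorphN i) (rmorphM i).
  have -> (P Q : 'M[M]_1) : (P + Q) 0 0 = P 0 0 + Q 0 0 by rewrite mxE.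
  have -> (a : M) (P : 'M[M]_1) : (a *: P) 0 0 = a * P 0 0 by rewrite mxE.
  by rewrite [X in _ + X = _]mxE mulr1n; ring.
have [M [i [t]]] := generic_point (row_mx w0 1%:M) (row_mx E (0 : 'M_(N, 1))).
rewrite !map_row_mx map_mx1 map_mx0 mul_mx_row mulmx0 add_row_mx addr0.
set w := map_mx i w0 + _; case=> anM _ linM.
have wX : w *m map_mx i Xi = map_mx i rhs.
  by rewrite mulmxDl -mulmxA -!map_mxM EX map_mx0 mulmx0 addr0 Dw0.
pose be := pmap (map_mx i G) w (map_mx i u).
pose ga := qmap (map_mx i G) w - i c0.
have cE (M' : fieldType) (j : {rmorphism M -> M'}) m1 m2 (X : 'M[L]_(m1, m2)) :
    map_mx (j \o i) X = map_mx j (map_mx i X) by rewrite -map_mx_comp.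
have sol (M' : fieldType) (j : {rmorphism M -> M'}) x :
    j (i al) * x ^+ 2 + j be * x + j ga = 0 ->
  exists w' : 'rV[M']_N, qmap (map_mx (j \o i) G) w' = (j \o i) c0 /\
    w' *m map_mx (j \o i) Xi = map_mx (j \o i) rhs.
  move=> ex; exists (map_mx j w + x *: map_mx j (map_mx i u)).
  rewrite !cE mulmxDl -scalemxAl -!map_mxM wX uX !map_mx0 scaler0 addr0.
  split=> //; rewrite qmapD qmapZ pmapZr !qmap_map pmap_map -/be -/al.
  apply/eqP; rewrite -subr_eq0 -ex rmorphB /=; apply/eqP; ring.
(* Cassels-Pfister descent: X contains al times the form of the quadric. *)
have nval (X : 'M_N) : XX X \/ X = G ->
    forall z, qmap (map_mx i X) z <> i al * ga.
  move=> hX z qz.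
  have aX : anisotropic X by case: hX => [/anX//|->].
  have [||y0 [Y hY]] := linM N 0 X G' 0 0 z aX.
  - have := qG' M i w 1; rewrite expr1n mulr1 => ->; exact: qz.
  - by apply/rowP => -[].
  have {}hY d c : qmap X (d *: y0 + c *m Y) =
      al * (qmap G (d *: w0 + c *m E) - c0 * d ^+ 2).
    have [-> _] := hY d c.
    rewrite scale_row_mx scalemx1 mul_mx_row mulmx0 add_row_mx addr0.
    by have := qG' L idfun (d *: w0 + c *m E) d; rewrite !map_mx_id.
  have rd1 : round G by have := rdG (i := idfun); rewrite map_mx_id.
  have [S hS] := rd1 u nz_al.
  case: hX => [XX_X | eXG].
    (* At [d = 0] the identity [hY] says that X contains al times the restriction of G to E. The
       similarity S turns this into the restriction of G to [E S], a common subform of dimension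
       greater than r. *)
    have frS : row_free S.
      apply: inj_row_free => v vS; apply: anG; apply: (mulfI nz_al).
      by rewrite -hS vS qmap0 mulr0.
    have := @subX X XX_X _ (E *m S) Y.
    rewrite mxrankMfree // leqNgt rank_ker => h; suff: false by [].
    apply: h => c; have := hY 0 c.
    by rewrite !scale0r !add0r (mulmxA c E S) hS expr0n mulr0 subr0 => <-.
  (* For G itself, scaling back by al and extending by Witt replaces y0 by x0 with
     [G(d x0 + c E) = G(d w0 + c E) - c0 d ^ 2]. Then [x0 - w0] is orthogonal to E, so it is some
     [c' V], and comparing values gives [A(y + c' T) = 0]: y would lie in the span of T. *)
  subst X.
  have [S' hS'] := similarV nz_al (rd1 u nz_al).
  have [|H [isoH YH]] := @witt_extension _ _ _ _ (Y *m S') E anG.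
    move=> c; rewrite (mulmxA c Y S') hS'; have := hY 0 c.
    rewrite !scale0r !add0r expr0n mulr0 subr0 => ->.
    by rewrite mulKf.
  pose x0 := y0 *m S' *m H.
  have hx d c :
    qmap G (d *: x0 + c *m E) = qmap G (d *: w0 + c *m E) - c0 * d ^+ 2.
    rewrite -[in LHS]YH /x0 !scalemxAl (mulmxA c (Y *m S') H)
      (mulmxA c Y S') -!mulmxDl isoH hS' hY.
    by rewrite mulKf.
  have qx0 : qmap G x0 = qmap G w0 - c0.
    by have := hx 1 0; rewrite !mul0mx !addr0 !scale1r expr1n mulr1.
  have [|c' Dv] := @ker_perp (x0 - w0).
    apply/rowP => j; have := hx 1 (delta_mx 0 j).
    rewrite !scale1r !qmapD qx0 expr1n mulr1 => e.
    have : pmap G (x0 - w0) (delta_mx 0 j *m E) = 0.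
      rewrite pmapDl pmapNl; apply/eqP; rewrite subr_eq0; apply/eqP.
      by apply: (addrI (qmap G w0 - c0 + qmap G (delta_mx 0 j *m E)));
        rewrite e; ring.
    rewrite /pmap trmx_mul trmx_delta mulmxA -colE [X in _ -> _ = X]mxE => <-.
    by rewrite [RHS]mxE.
  case: nspan; exists (- c'); apply/eqP; rewrite mulNmx -addr_eq0; apply/eqP.
  apply: anA; rewrite qmapD isoTV -/c0.
  have -> : pmap A y (c' *m T) = pmap G w0 (c' *m V).
    by rewrite /pmap !trmx_mul !mulmxA -/rhs -Dw0 /Xi !mulmxA.
  move: qx0; rewrite -[x0](subrK w0) Dv qmapD [pmap _ (_ *m _) _]pmapC => e.
  by apply: (addrI (qmap G w0 - c0)); rewrite addr0 -[RHS]e; ring.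
have nz_ial : i al != 0 by rewrite fmorph_eq0.
have [[x ex]|[M' [j [x [ex an']]]]] := quadratic_extension be ga nz_ial.
  have [w' [q' l']] := sol M idfun x ex.
  exists M, (idfun \o i), w'; split=> // [|X XX_X].
    by rewrite cE map_mx_id //; apply: anM.
  by rewrite cE map_mx_id //; apply/anM/anX.
have [w' [q' l']] := sol M' j x ex.
exists M', (j \o i), w'; split=> // [|X XX_X].
  rewrite cE; apply: an'; [exact: anM | exact: rdG | apply: nval].
  by right.
rewrite cE; apply: an'; [exact/anM/anX | exact: rdX | apply: nval].
by left.
Qed.

End ExtensionStep.

(** * Pfister forms *)

Section Double.
Variables (K : fieldType) (N : nat).
Implicit Types (A : 'M[K]_N) (a : K).

(* The matrix of <1, a> (x) A. *)
Definition dbl a A : 'M[K]_(N + N) := block_mx A 0 0 (a *: A).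

Lemma qmap_dbl a A u v : qmap (dbl a A) (row_mx u v) = qmap A u + a * qmap A v.
Proof.
rewrite /qmap mul_row_block tr_row_mx mul_row_col !mulmx0 addr0 add0r.
by rewrite -scalemxAr -scalemxAl [LHS]mxE; congr (_ + _); rewrite mxE.
Qed.

Lemma pmap_dbl a A u v u' v' :
  pmap (dbl a A) (row_mx u v) (row_mx u' v') = pmap A u u' + a * pmap A v v'.
Proof. by rewrite !pmapE add_row_mx !qmap_dbl; ring. Qed.

Lemma qmap_dblE a A v :
  qmap (dbl a A) v = qmap A (lsubmx v) + a * qmap A (rsubmx v).
Proof. by rewrite -[in LHS](hsubmxK v) qmap_dbl. Qed.

Lemma pmap_dblE a A v w : pmap (dbl a A) v w =
  pmap A (lsubmx v) (lsubmx w) + a * pmap A (rsubmx v) (rsubmx w).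
Proof. by rewrite -[in LHS](hsubmxK v) -[in LHS](hsubmxK w) pmap_dbl. Qed.

Lemma map_dbl (L : fieldType) (i : {rmorphism K -> L}) a A :
  map_mx i (dbl a A) = block_mx (map_mx i A) 0 0 (i a *: map_mx i A).
Proof. by rewrite map_block_mx !map_mx0 map_mxZ. Qed.

Lemma nondegenerate_dbl a A : a != 0 -> nondegenerate A ->
  nondegenerate (dbl a A).
Proof.
move=> nz_a; rewrite /nondegenerate !unitmxE tr_block_mx !trmx0 add_block_mx
  !addr0.
rewrite linearZ /= -scalerDr det_ublock detZ !unitfE => h.
by rewrite !mulf_neq0 // expf_neq0.
Qed.

Lemma similar_dbl a A c d : c != 0 -> d != 0 -> c + a * d != 0 ->
  similar A c -> similar A d -> similar (dbl a A) (c + a * d).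
Proof.
move=> nz_c nz_d nz_e [S hS] [T hT].
have nz_cd : c * d != 0 by rewrite mulf_neq0.
(* <1, a> A is sent to <e, e a c d> A, then to <c, a d> A, then back. *)
exists (block_mx 1%:M 0 0 ((c * d)^-1 *: (S *m T)) *m
        (block_mx 1%:M 1%:M (- (a * d))%:M c%:M *m block_mx S 0 0 T)) => v.
rewrite -[v]hsubmxK; move: (lsubmx v) (rsubmx v) => x y.
rewrite mulmxA mul_row_block !mulmx0 add0r addr0 mulmx1 -scalemxAr.
rewrite mulmxA mul_row_block !mul_mx_scalar !scale1r mul_row_block !mulmx0 add0r
  addr0.
set y' := (c * d)^-1 *: _.
have qy' : qmap A y' = (c * d)^-1 * qmap A y by rewrite qmapZ mulmxA hT hS;
  field; rewrite nz_c nz_d.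
clearbody y';
  have -> : qmap (dbl a A) (row_mx ((x + - (a * d) *: y') *m S)
  ((x + c *: y') *m T)) =
   c * qmap A (x - (a * d) *: y') + a * (d * qmap A (x + c *: y')).
  by rewrite scaleNr qmap_dbl hS hT.
rewrite qmapB qmapD !qmapZ !pmapZr qy' qmap_dbl; field; rewrite nz_c nz_d //.
Qed.

Lemma similar_dbl_swap a A c : similar A c -> similar (dbl a A) (a * c).
Proof.
move=> [S hS]; exists (block_mx 0 S (a *: S) 0) => v.
rewrite -[v]hsubmxK; move: (lsubmx v) (rsubmx v) => x y.
rewrite mul_row_block !mulmx0 add0r addr0 -scalemxAr !qmap_dbl qmapZ !hS; ring.
Qed.

Lemma similar_dbl_diag a A c : similar A c -> similar (dbl a A) c.
Proof.
move=> [S hS]; exists (block_mx S 0 0 S) => v.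
rewrite -[v]hsubmxK; move: (lsubmx v) (rsubmx v) => x y.
by rewrite mul_row_block !mulmx0 add0r addr0 !qmap_dbl !hS; ring.
Qed.

(** A value is [c + a d] with c and d values of A, hence similarity factors of A when nonzero; the
    cases where one of them vanishes are treated apart. *)
Lemma round_dbl a A : round A -> round (dbl a A).
Proof.
move=> rdA v; rewrite qmap_dblE.
have [->|nz_c] := eqVneq (qmap A (lsubmx v)) 0.
  rewrite add0r mulf_eq0 negb_or => /andP[_ nz_d].
  exact/similar_dbl_swap/rdA.
have [->|nz_d] := eqVneq (qmap A (rsubmx v)) 0.
  by rewrite mulr0 addr0 => _; apply/similar_dbl_diag/rdA.
by move=> nz_e; apply: similar_dbl => //; apply: rdA.
Qed.

Lemma anisotropic_dbl a A : anisotropic (dbl a A) -> anisotropic A.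
Proof.
move=> anD v qv; have := anD (row_mx v 0).
rewrite qmap_dbl qv qmap0 mulr0 addr0 => /(_ erefl) e.
by rewrite -[v](row_mxKl v (0 : 'rV_N)) e linear0.
Qed.

End Double.

(** The orthogonal sum of [<1, x> A] and [- <1, y> A] is Witt equivalent to [<x, -y> A], which is
    anisotropic of dimension 2r; so its Witt index is r, and a common subform gives a totally
    isotropic subspace. The proof is a direct rank count. *)
Lemma common_subform (K : fieldType) r (A : 'M[K]_r) x y n (D g :
  'M_(n, r + r)) :
    nondegenerate A ->
    (forall u v, x * qmap A u = y * qmap A v -> u = 0 /\ v = 0) ->
    (forall c, qmap (dbl y A) (c *m D) = qmap (dbl x A) (c *m g)) ->
  (\rank D <= r)%N.
Proof.
move=> ndA anxy; have ndA' : A + A^T \in unitmx := ndA.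
wlog frD : n D g / row_free D => [wl|] h.
  have /submxP[P DP] : (row_base D <= D)%MS by rewrite eq_row_base.
  have eD : \rank (row_base D) = \rank D by rewrite eq_row_base.
  rewrite -eD; apply: (wl _ _ (P *m g)); first exact: row_base_free.
  by move=> c; rewrite DP !mulmxA h.
pose D1 := lsubmx D; pose D2 := rsubmx D; pose g1 := lsubmx g;
  pose g2 := rsubmx g.
have eD : D = row_mx D1 D2 by rewrite hsubmxK.
have eg : g = row_mx g1 g2 by rewrite hsubmxK.
(* The image of ka is orthogonal to the vectors c D1 with c in its kernel Z. *)
pose ka := D1 - g1; pose Z := kermx ka.
have hk (c : 'rV_n) :
  c *m ka = 0 -> [/\ c *m D1 = c *m g1, c *m D2 = 0 & c *m g2 = 0].
  rewrite mulmxBr => /eqP; rewrite subr_eq0 => /eqP e1.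
  have := h c; rewrite eD eg !mul_mx_row !qmap_dbl e1 => /addrI/esym e.
  by have [-> ->] := anxy _ _ e.
have rank_sum : (\rank ka + \rank (Z *m D1) <= r)%N.
  have z : (ka *m (A + A^T)) *m (Z *m D1)^T = 0.
    apply/matrixP => i j;
      rewrite [RHS]mxE -pmap_rows (row_mul j Z D1) (rowE i ka).
    have dk : row j Z *m ka = 0 by rewrite -row_mul mulmx_ker row0.
    have [d1 d2 d3] := hk _ dk.
    have := isom_pmap h (delta_mx 0 i) (row j Z).
    rewrite eD eg !mul_mx_row !pmap_dbl d2 d3 !pmap0r !mulr0 !addr0 -d1 => e.
    by rewrite mulmxBr pmapDl pmapNl e subrr.
  have frA : row_free (A + A^T) by rewrite row_free_unit.
  by have := mulmx0_rank_max z; rewrite mxrank_tr (mxrankMfree _ frA).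
apply: leq_trans rank_sum.
have -> : \rank (Z *m D1) = \rank (Z *m D).
  rewrite eD mul_mx_row; have -> : Z *m D2 = 0.
    apply/row_matrixP => i; rewrite row_mul row0.
    by have [] := hk (row i Z); rewrite // -row_mul mulmx_ker row0.
  by rewrite rank_row_mx0.
rewrite mxrankMfree // mxrank_ker (eqP frD) subnKC //.
exact: rank_leq_row.
Qed.

(** * Embeddings of forms and identities between Pfister forms *)

Section Embeddings.
Variable K : fieldType.

(** Injectivity is automatic for a nondegenerate source ([emb_inj]); in equal dimensions such an
    embedding is an isometry. *)
Definition emb N N' (A : 'M[K]_N) (A' : 'M[K]_N') : Prop :=
  exists P : 'M_(N, N'), forall v, qmap A' (v *m P) = qmap A v.

Lemma emb_refl N (A : 'M[K]_N) : emb A A.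
Proof. by exists 1%:M => v; rewrite mulmx1. Qed.

Lemma emb_trans N1 N2 N3 (A : 'M[K]_N1) (B : 'M[K]_N2) (C : 'M[K]_N3) :
  emb A B -> emb B C -> emb A C.
Proof. by move=> [P hP] [Q hQ]; exists (P *m Q) => v; rewrite mulmxA hQ hP. Qed.

Lemma emb_inj N N' (A : 'M[K]_N) (A' : 'M[K]_N') P :
  nondegenerate A -> (forall v, qmap A' (v *m P) = qmap A v) ->
  row_free P.
Proof.
move=> ndA hP; apply: inj_row_free => v vP; apply: (nondegenerateP ndA) => w.
by rewrite pmapE -!hP mulmxDl vP add0r qmap0; ring.
Qed.

Lemma emb_inv N N' (A : 'M[K]_N) (A' : 'M[K]_N') :
  N = N' -> nondegenerate A -> emb A A' -> emb A' A.
Proof.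
move=> e; subst N' => ndA [P hP]; have := emb_inj ndA hP.
rewrite row_free_unit => uP; exists (invmx P) => v.
by rewrite -hP mulmxKV.
Qed.

Lemma emb_anisotropic N N' (A : 'M[K]_N) (A' : 'M[K]_N') :
  nondegenerate A -> emb A A' -> anisotropic A' -> anisotropic A.
Proof.
move=> ndA [P hP] anA' v qv; apply: (row_free_inj (emb_inj ndA hP)).
by rewrite mul0mx; apply: anA'; rewrite hP.
Qed.

Lemma emb_dbl a N N' (A : 'M[K]_N) (A' : 'M[K]_N') :
  emb A A' -> emb (dbl a A) (dbl a A').
Proof.
move=> [P hP]; exists (block_mx P 0 0 P) => v; rewrite -[v]hsubmxK.
by rewrite mul_row_block !mulmx0 add0r addr0 !qmap_dbl !hP.
Qed.

Lemma emb_dbl_similar a c N (A : 'M[K]_N) :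
  c != 0 -> similar A c -> emb (dbl a A) (dbl (a * c) A).
Proof.
move=> nz_c /(similarV nz_c)[S hS]; exists (block_mx 1%:M 0 0 S) => v.
rewrite -[v]hsubmxK mul_row_block !mulmx0 add0r addr0 !qmap_dbl mulmx1 hS.
by field.
Qed.

Lemma emb_dbl_swap a c N (A : 'M[K]_N) :
  emb (dbl a (dbl c A)) (dbl c (dbl a A)).
Proof.
exists (block_mx (block_mx 1%:M 0 0 0) (block_mx 0 0 1%:M 0)
                 (block_mx 0 1%:M 0 0) (block_mx 0 0 0 1%:M)) => v.
rewrite -[v]hsubmxK; move: (lsubmx v) (rsubmx v) => {v} x y.
rewrite -[x]hsubmxK -[y]hsubmxK;
  move: (lsubmx x) (rsubmx x) (lsubmx y) (rsubmx y).
move=> p0 p1 p2 p3;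
  rewrite !mul_row_block !mulmx0 !mulmx1 !add_row_mx !(add0r, addr0).
rewrite !qmap_dbl; ring.
Qed.

(** The identity [<<a, c>> = <<a + c, a c>>] of bilinear Pfister forms, tensored with A. *)
Lemma emb_dbl_add a c N (A : 'M[K]_N) : a + c != 0 ->
  emb (dbl a (dbl c A)) (dbl (a + c) (dbl (a * c) A)).
Proof.
set e := a + c => nz_e.
exists (block_mx (block_mx 1%:M 0 0 0) (block_mx 0 0 (c / e)%:M (- e^-1)%:M)
                 (block_mx 0 0 0 1%:M) (block_mx (a / e)%:M e^-1%:M 0 0)) => v.
rewrite -[v]hsubmxK; move: (lsubmx v) (rsubmx v) => {v} x y.
rewrite -[x]hsubmxK -[y]hsubmxK;
  move: (lsubmx x) (rsubmx x) (lsubmx y) (rsubmx y).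
move=> p0 p1 p2 p3;
  rewrite !mul_row_block !mulmx0 !mulmx1 !add_row_mx !(add0r, addr0).
rewrite !mul_mx_scalar !qmap_dbl !qmapD !qmapZ !pmapZl !pmapZr.
by move: nz_e; rewrite /e => nz_e; field.
Qed.

Fixpoint pfd (s : seq K) N : nat :=
  if s is _ :: s' then (pfd s' N + pfd s' N)%N else N.

(* The form <<s>> (x) A: see emb_pfm_qtens. *)
Fixpoint pfm (s : seq K) N (A : 'M[K]_N) : 'M_(pfd s N) :=
  if s is a :: s' then dbl a (pfm s' A) else A.

(** The inclusion of A as the summand [<1> A] of [<<s>> A], called the base copy below. *)
Fixpoint pfi (s : seq K) N : 'M[K]_(N, pfd s N) :=
  if s is _ :: s' then row_mx (pfi s' N) 0 else 1%:M.

Lemma pfdE s N : pfd s N = (2 ^ size s * N)%N.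
Proof. by elim: s => [|a s IH] /=;
  rewrite ?mul1n // IH expnS mul2n addnn -doubleMl. Qed.

Lemma qmap_pfi s N (A : 'M[K]_N) v : qmap (pfm s A) (v *m pfi s N) = qmap A v.
Proof.
elim: s => [|a s IH] /=; first by rewrite mulmx1.
by rewrite mul_mx_row mulmx0 qmap_dbl qmap0 mulr0 addr0.
Qed.

Definition nonzeros (s : seq K) := all (fun a => a != 0) s.

Lemma round_pfm s N (A : 'M[K]_N) : round A -> round (pfm s A).
Proof. by move=> rdA; elim: s => //= a s IH; apply: round_dbl. Qed.

Lemma nondegenerate_pfm s N (A : 'M[K]_N) :
  nonzeros s -> nondegenerate A -> nondegenerate (pfm s A).
Proof. by move=> + ndA; elim: s => //= a s IH /andP[nz_a /IH];
  apply: nondegenerate_dbl. Qed.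

Lemma emb_pfm s N N' (A : 'M[K]_N) (A' : 'M[K]_N') :
  emb A A' -> emb (pfm s A) (pfm s A').
Proof. by move=> h; elim: s => //= a s; apply: emb_dbl. Qed.

Lemma emb_pfm_dbl a s N (A : 'M[K]_N) :
  emb (dbl a (pfm s A)) (pfm s (dbl a A)) /\
  emb (pfm s (dbl a A)) (dbl a (pfm s A)).
Proof.
elim: s => /= [|c s [IH1 IH2]]; first by split; apply: emb_refl.
split; first exact: emb_trans (emb_dbl_swap _ _ _) (emb_dbl c IH1).
exact: emb_trans (emb_dbl c IH2) (emb_dbl_swap _ _ _).
Qed.

(** Pure subform theorem: a nonzero value taken orthogonally to the base copy can be made a slot.
    With [w = (w1, w2)] of values c1 and c2, roundness replaces a by [a c2], induction makes c1 a
    slot, and [emb_dbl_add] merges the two into [a c2 + c1]. *)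
Lemma slot s N (A : 'M[K]_N) w :
    round A -> nondegenerate A -> nonzeros s -> anisotropic (pfm s A) ->
    (forall t, pmap (pfm s A) w (t *m pfi s N) = 0) -> qmap (pfm s A) w != 0 ->
  exists s', [/\ (size s').+1 = size s, nonzeros s'
               & emb (pfm s A) (pfm (qmap (pfm s A) w :: s') A)].
Proof.
move=> rdA ndA; elim: s w => [|a s IH] w /=.
  move=> _ _ h; rewrite (nondegenerateP ndA (v := w)) ?qmap0 ?eqxx //.
  by move=> t; have := h t; rewrite mulmx1.
move=> /andP[nz_a nz_s] anP; have anP' := anisotropic_dbl anP.
have rdP : round (pfm s A) := round_pfm rdA.
rewrite qmap_dblE; move: (lsubmx w) (rsubmx w) (pmap_dblE a (pfm s A) w).
move=> w1 w2 hw orth.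
have {orth hw} : forall t, pmap (pfm s A) w1 (t *m pfi s N) = 0.
  move=> t; rewrite -[RHS](orth t) hw mul_mx_row mulmx0 row_mxKl row_mxKr.
  by rewrite pmap0r mulr0 addr0.
move=> orth; have [c20|nz_c2] := eqVneq (qmap (pfm s A) w2) 0.
  rewrite c20 mulr0 addr0 => nz_c1.
  have [s' [ss' nz_s' h]] := IH w1 nz_s anP' orth nz_c1.
  exists (a :: s'); rewrite /= ss' nz_a; split=> //.
  exact: emb_trans (emb_dbl a h) (emb_dbl_swap _ _ _).
have h2 := emb_dbl_similar a nz_c2 (rdP _ nz_c2).
have [c10|nz_c1] := eqVneq (qmap (pfm s A) w1) 0.
  by rewrite c10 add0r => nz_c; exists s.
have [s' [ss' nz_s' h]] := IH w1 nz_s anP' orth nz_c1.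
rewrite addrC => nz_e; exists (a * qmap (pfm s A) w2 * qmap (pfm s A) w1 :: s').
rewrite /= ss' !mulf_neq0 //; split=> //.
apply: emb_trans h2 _; apply: emb_trans (emb_dbl _ h) _.
exact: emb_dbl_add.
Qed.

End Embeddings.

(** * Binary norm forms, and subforms that are factors *)

Section Binary.
Variable K : fieldType.
Implicit Types (b x y : K).

(* The matrix of the norm form [1, b] of K[w] / (w^2 - w + b).                *)
Definition qb b : 'M[K]_(1 + 1) := block_mx 1%:M 1%:M 0 b%:M.

Definition vec2 x y : 'rV[K]_(1 + 1) := row_mx x%:M y%:M.

Lemma vec2P (v : 'rV[K]_(1 + 1)) : exists x y, v = vec2 x y.
Proof.
by exists (lsubmx v 0 0), (rsubmx v 0 0); rewrite /vec2 -!mx11_scalar hsubmxK.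
Qed.

Lemma vec2M x y a b c d :
  vec2 x y *m block_mx a%:M b%:M c%:M d%:M = vec2 (x * a + y * c)
    (x * b + y * d).
Proof. by rewrite /vec2 mul_row_block -!scalar_mxM -!raddfD. Qed.

Lemma vec2D x y x' y' : vec2 x y + vec2 x' y' = vec2 (x + x') (y + y').
Proof. by rewrite /vec2 add_row_mx -!raddfD. Qed.

Lemma qmap_qb b x y : qmap (qb b) (vec2 x y) = x ^+ 2 + x * y + b * y ^+ 2.
Proof.
rewrite /qmap /qb -[0 :
  'M_1](raddf0 scalar_mx) vec2M /vec2 tr_row_mx mul_row_col !tr_scalar_mx.
by rewrite -!scalar_mxM -raddfD mxE mulr1n; ring.
Qed.

Lemma pmap_qb b x y x' y' : pmap (qb b) (vec2 x y) (vec2 x' y') =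
  x * x' *+ 2 + x * y' + y * x' + b * (y * y') *+ 2.
Proof. by rewrite pmapE vec2D !qmap_qb; ring. Qed.

Lemma round_qb b : round (qb b).
Proof.
move=> v _; have [x [y ->]] := vec2P v.
exists (block_mx x%:M y%:M (- (b * y))%:M (x + y)%:M) => u.
by have [p [q ->]] := vec2P u; rewrite vec2M !qmap_qb; ring.
Qed.

Lemma nondegenerate_qb b : 1 - 4 * b != 0 -> nondegenerate (qb b).
Proof.
move=> nz; rewrite /nondegenerate unitmxE unitfE.
apply: contraNneq nz => d0.
have e : (qb b + (qb b)^T) *m block_mx (b * 2)%:M (-1)%:M (-1)%:M 2%:M =
    - (1 - 4 * b)%:M :> 'M_(1 + 1).
  rewrite /qb tr_block_mx !tr_scalar_mx trmx0 add_block_mx -[0 :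
    'M_1](raddf0 scalar_mx) -!raddfD.
  rewrite mulmx_block -!scalar_mxM -!raddfD /= -raddfN /=
    scalar_mx_block -(raddf0 scalar_mx).
  congr block_mx; congr _%:M; ring.
have := congr1 determinant e; rewrite det_mulmx d0 mul0r -raddfN /= det_scalar.
by move/esym/eqP; rewrite expf_eq0 /= oppr_eq0.
Qed.

(** The element [x + y w] of [K[w]] has trace [2 x + y = 1] and generates the algebra, so its norm
    may replace b. *)
Lemma emb_qb b x y : y != 0 -> 2 * x + y = 1 -> 
  emb (qb b) (qb (x ^+ 2 + x * y + b * y ^+ 2)).
Proof.
move=> nz_y e; exists (block_mx 1%:M 0%:M (- (x / y))%:M y^-1%:M) => v.
have [p [q ->]] := vec2P v; rewrite vec2M !qmap_qb.
have ey : y = 1 - 2 * x by apply: (addrI (2 * x)); rewrite e; ring.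
by move: nz_y; rewrite ey => nz_y; field.
Qed.

Definition vec4 x y x' y' := row_mx (vec2 x y) (vec2 x' y').

Lemma vec4P (v : 'rV[K]_((1 + 1) + (1 + 1))) :
  exists x y x' y', v = vec4 x y x' y'.
Proof.
have [x [y e]] := vec2P (lsubmx v); have [x' [y' e']] := vec2P (rsubmx v).
by exists x, y, x', y'; rewrite /vec4 -e -e' hsubmxK.
Qed.

Lemma qmap_vec4 a b x y x' y' : qmap (dbl a (qb b)) (vec4 x y x' y') =
  x ^+ 2 + x * y + b * y ^+ 2 + a * (x' ^+ 2 + x' * y' + b * y' ^+ 2).
Proof. by rewrite qmap_dbl !qmap_qb. Qed.

Lemma vec4M p q p' q' x0 y0 x0' y0' x1 y1 x1' y1' x2 y2 x2' y2' x3 y3 x3' y3' :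
  vec4 p q p' q' *m col_mx (col_mx (vec4 x0 y0 x0' y0') (vec4 x1 y1 x1' y1'))
                           (col_mx (vec4 x2 y2 x2' y2') (vec4 x3 y3 x3' y3')) =
  vec4 (p * x0 + q * x1 + (p' * x2 + q' * x3))
    (p * y0 + q * y1 + (p' * y2 + q' * y3))
       (p * x0' + q * x1' + (p' * x2' + q' * x3'))
         (p * y0' + q * y1' + (p' * y2' + q' * y3')).
Proof.
rewrite /vec4 mul_row_col /vec2 !mul_row_col !mul_scalar_mx.
by rewrite !scale_row_mx !scale_scalar_mx !add_row_mx -!raddfD.
Qed.

(* In the quaternion algebra K[w] + K[w] j with j^2 = - a, the element w + j  *)
(* has trace 1 and norm b + a, and (2 w - 1) j anticommutes with it.          *)
Lemma emb_quaternion a b : 1 - 4 * (b + a) != 0 ->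
  emb (dbl a (qb b)) (dbl (a * (4 * b - 1)) (qb (b + a))).
Proof.
move=> nz; pose e := (1 - 4 * (b + a))^-1; pose be := b + a.
exists (col_mx
  (col_mx (vec4 1 0 0 0) (vec4 (- (2 * e * a)) (1 + 4 * a * e) (1 + 4 * be * e)
    (- (2 * e))))
  (col_mx (vec4 (2 * e * a) (- (4 * a * e)) (- 1 - 4 * be * e) (2 * e))
          (vec4 (e * a) (- (2 * a * e)) (- (2 * be * e)) e))) => v.
have [p [q [p' [q' ->]]]] := vec4P v.
by rewrite vec4M !qmap_vec4 /e /be; field.
Qed.

(** Away from characteristic 2 the form [[1, c]] is [<1, c - 1/4>], and both sides are the norm form
    [<<a, b - 1/4>>]. *)
Lemma emb_quaternion_diag a b : (2 : K) != 0 ->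
  emb (dbl a (qb b)) (dbl (b - 4^-1) (qb (4^-1 + a))).
Proof.
move=> nz2; have e4 : (4 : K) = 2 * 2 by ring.
have nz4 : (4 : K) != 0 by rewrite e4 mulf_neq0.
exists (col_mx
  (col_mx (vec4 1 0 0 0) (vec4 2^-1 0 1 0))
  (col_mx (vec4 (- 2^-1) 1 0 0) (vec4 (- 4^-1) 2^-1 (- 2^-1) 1))) => v.
have [p [q [p' [q' ->]]]] := vec4P v.
by rewrite vec4M !qmap_vec4; field; rewrite nz2 nz4.
Qed.

(** The counterpart of [slot] for the binary factor: w behaves like an element of trace 1. Its
    component w1 again has trace 1, and [emb_quaternion] moves the contribution [a'] of the other
    component into the binary form. *)
Lemma base_slot s b w :
    1 - 4 * b != 0 -> nonzeros s -> anisotropic (pfm s (qb b)) ->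
    pmap (pfm s (qb b)) (vec2 1 0 *m pfi s (1 + 1)) w = 1 ->
    1 - 4 * qmap (pfm s (qb b)) w != 0 ->
  exists s', [/\ size s' = size s, nonzeros s'
               & emb (pfm s (qb b)) (pfm s' (qb (qmap (pfm s (qb b)) w)))].
Proof.
move=> nz_b; elim: s w => [|a s IH] w /=.
  move=> _ _; have [x [y ->]] := vec2P w.
  rewrite mulmx1 qmap_qb pmap_qb => e nz; exists [::]; split=> //.
  have {}e : 2 * x + y = 1 by rewrite -[RHS]e; ring.
  apply: emb_qb => //; apply: contraNneq nz => y0.
  have ex : 2 * x = 1 by move: e; rewrite y0 addr0.
  rewrite y0 (_ : 1 - _ = 1 - (2 * x) ^+ 2); last by ring.
  by rewrite ex expr1n subrr.
move=> /andP[nz_a nz_s] anP; have anP' := anisotropic_dbl anP.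
have rdP : round (pfm s (qb b)) by apply/round_pfm/round_qb.
rewrite qmap_dblE pmap_dblE mul_mx_row mulmx0 row_mxKl row_mxKr pmap0l mulr0
  addr0.
move: (lsubmx w) (rsubmx w) => w1 w2 e.
have [c20|nz_c2] := eqVneq (qmap (pfm s (qb b)) w2) 0.
  rewrite c20 mulr0 addr0 => nz.
  have [s' [ss' nz_s' h]] := IH w1 nz_s anP' e nz.
  by exists (a :: s'); rewrite /= ss' nz_a; split=> //; apply: emb_dbl.
have h2 := emb_dbl_similar a nz_c2 (rdP _ nz_c2).
set a' := a * _ in h2 *; set b1 := qmap _ w1.
have nz_a' : a' != 0 by rewrite mulf_neq0.
(* If [b1 = 1/4] then [[1, b1]] is degenerate and the induction hypothesis does not apply. The
   characteristic is then not 2, and the diagonal quaternion identity is applied to [[1, b]]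
   directly. *)
have [d0|nz_d] := eqVneq (1 - 4 * b1) 0.
  move=> nz; have e4 : (4 : K) = 2 * 2 by ring.
  have nz2 : (2 : K) != 0.
    apply/eqP => z2; move/eqP: d0; rewrite e4 z2 !mul0r subr0.
    by rewrite (negPf (oner_neq0 K)).
  have nz4 : (4 : K) != 0 by rewrite e4 mulf_neq0.
  have eb1 : b1 = 4^-1.
    apply: (mulfI nz4); rewrite mulfV //.
    by apply/esym/eqP; rewrite -subr_eq0 d0.
  exists (b - 4^-1 :: s); split=> //=.
    rewrite nz_s andbT; apply: contraNneq nz_b => z.
    rewrite (_ : 1 - 4 * b = - (4 * (b - 4^-1))); last by field.
    by rewrite z mulr0 oppr0.
  rewrite eb1; apply: emb_trans h2 _.
  apply: emb_trans (proj1 (emb_pfm_dbl _ _ _)) _.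
  apply: emb_trans (emb_pfm s (emb_quaternion_diag _ _ nz2)) _.
  exact: (proj2 (emb_pfm_dbl _ _ _)).
move=> nz; have [s' [ss' nz_s' h]] := IH w1 nz_s anP' e nz_d.
exists (a' * (4 * b1 - 1) :: s'); rewrite /= ss' nz_s' andbT; split=> //.
  by rewrite mulf_neq0 // -oppr_eq0 opprB.
apply: emb_trans h2 _; apply: emb_trans (emb_dbl _ h) _.
apply: emb_trans (proj1 (emb_pfm_dbl _ _ _)) _.
apply: emb_trans (emb_pfm s' (emb_quaternion nz)) _.
exact: (proj2 (emb_pfm_dbl _ _ _)).
Qed.

(** Induction on the slots of the subform: its binary part is made the binary factor by [base_slot],
    then each further entry c is split off by [slot]. Witt extension supplies the normal positions
    these two need. *)
Lemma subform_factor s t b be (J : 'M_(_, _)) :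
    1 - 4 * b != 0 -> 1 - 4 * be != 0 -> nonzeros s -> nonzeros t ->
    anisotropic (pfm s (qb b)) ->
    (forall v, qmap (pfm s (qb b)) (v *m J) = qmap (pfm t (qb be)) v) ->
  exists s', [/\ (size s' + size t)%N = size s, nonzeros s'
               & emb (pfm s (qb b)) (pfm s' (pfm t (qb be)))].
Proof.
move=> nz_b nz_be nz_s + anP.
have ndP : nondegenerate (pfm s (qb b))
  by apply/nondegenerate_pfm/nondegenerate_qb.
elim: t J => [|c t IH] J /= nz_t hJ.
  (* The image of the unit of [[1, be]] is moved to the unit of the large form; the generator
     [vec2 0 1] then has trace 1 and norm be. *)
  have [|H [isoH YH]] := @witt_extension _ _ _ _ (vec2 1 0 *m J)
    (vec2 1 0 *m pfi s _) anP.
    by move=> d; rewrite !mulmxA hJ qmap_pfi [d]mx11_scalar mul_scalar_mx !qmapZ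
      !qmap_qb; ring.
  have hJH v : qmap (pfm s (qb b)) (v *m (J *m H)) = qmap (qb be) v.
    by rewrite mulmxA isoH hJ.
  have [||s' [ss' nz_s' h]] :=
    @base_slot s b (vec2 0 1 *m (J *m H)) nz_b nz_s anP.
  - have hp := isom_pmap1 hJH (vec2 1 0) (vec2 0 1).
    by move: hp; rewrite -YH -mulmxA => ->; rewrite pmap_qb; ring.
  - by rewrite hJH qmap_qb (_ : 1 - _ = 1 - 4 * be) //; ring.
  move: h; rewrite hJH qmap_qb (_ : _ + be * _ = be); last by ring.
  by exists s'; rewrite addn0.
move: nz_t => /andP[nz_c nz_t].
set S := pfm t (qb be) in IH hJ *.
have [|s1 [ss1 nz_s1 [P hP]]] := IH (usubmx J) nz_t.
  move=> v; have := hJ (row_mx v 0).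
  rewrite qmap_dbl qmap0 mulr0 addr0 => <-.
  by rewrite -[in RHS](vsubmxK J) mul_row_col mul0mx addr0.
have ndS : nondegenerate S by apply/nondegenerate_pfm/nondegenerate_qb.
have rdS : round S by apply/round_pfm/round_qb.
have ndP1 : nondegenerate (pfm s1 S) by apply: nondegenerate_pfm.
have anP1 : anisotropic (pfm s1 S).
  apply: emb_anisotropic ndP1 _ anP; apply: (emb_inv _ ndP); last by exists P.
  by rewrite !pfdE -ss1 expnD mulnA.
pose J1 := J *m P.
have hJ1 v : qmap (pfm s1 S) (v *m J1) = qmap (dbl c S) v
  by rewrite mulmxA hP hJ.
(* The first half of [<1, c> S] is moved onto the base copy of S. The unit of the second half
   becomes a vector of value c orthogonal to that copy. *)
have [|H [isoH YH]] := @witt_extension _ _ _ _ (usubmx J1) (pfi s1 _) anP1.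
  move=> v; rewrite qmap_pfi; have := hJ1 (row_mx v 0).
  rewrite qmap_dbl qmap0 mulr0 addr0 => <-.
  by rewrite -[in RHS](vsubmxK J1) mul_row_col mul0mx addr0.
have hJ2 v : qmap (pfm s1 S) (v *m (J1 *m H)) = qmap (dbl c S) v
  by rewrite mulmxA isoH.
pose u := vec2 1 0 *m pfi t _.
have qu : qmap S u = 1 by rewrite qmap_pfi qmap_qb; ring.
pose w := row_mx 0 u *m (J1 *m H).
have qw : qmap (pfm s1 S) w = c by rewrite hJ2 qmap_dbl qmap0 qu; ring.
have [||s2 [ss2 nz_s2 h]] := slot rdS ndS nz_s1 anP1 (w := w).
- move=> v; rewrite -YH mulmxA.
  have -> : v *m usubmx J1 = row_mx v 0 *m J1.
    by rewrite -[in RHS](vsubmxK J1) mul_row_col mul0mx addr0.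
  rewrite -mulmxA (isom_pmap1 hJ2) pmap_dbl pmap0l pmap0r; ring.
- by rewrite qw.
exists s2; split=> //; first by rewrite addnS -addSn ss2.
have h1 : emb (pfm s (qb b)) (pfm s1 S) by exists P.
rewrite qw in h; apply: emb_trans h1 _; apply: emb_trans h _.
exact: (proj1 (emb_pfm_dbl _ _ _)).
Qed.

End Binary.

(** * Isotropic Pfister forms are hyperbolic *)

Section Hyperbolic.
Variable K : fieldType.

Definition hyp n : 'M[K]_(n + n) := block_mx 0 1%:M 0 0.

Lemma qmap_hyp n (u w : 'rV_n) : qmap (hyp n) (row_mx u w) = (u *m w^T) 0 0.
Proof.
by rewrite /qmap mul_row_block !mulmx0 !addr0 mulmx1 tr_row_mx mul_row_col
  mul0mx add0r.
Qed.

Lemma emb_dbl_hyp a n : emb (dbl a (hyp n)) (hyp (n + n)).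
Proof.
exists (block_mx (block_mx 1%:M 0 0 0) (block_mx 0 0 1%:M 0)
                 (block_mx 0 1%:M 0 0) (block_mx 0 0 0 a%:M)) => v.
rewrite -[v]hsubmxK; move: (lsubmx v) (rsubmx v) => {v} x y.
rewrite -[x]hsubmxK -[y]hsubmxK;
  move: (lsubmx x) (rsubmx x) (lsubmx y) (rsubmx y).
move=> p0 p1 p2 p3;
  rewrite !mul_row_block !mulmx0 !mulmx1 !add_row_mx !(add0r, addr0).
rewrite qmap_dbl !qmap_hyp tr_row_mx mul_row_col mul_mx_scalar
  [(a *: _)^T]linearZ /=.
by rewrite -scalemxAr [LHS]mxE; congr (_ + _); rewrite mxE.
Qed.

(** The factorization [A(x) - A(y) = (x - y) (x A^T + y A)^T] holds for any matrix A, in every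
    characteristic. *)
Lemma emb_dbl_opp N (A : 'M[K]_N) : emb (dbl (-1) A) (hyp N).
Proof.
exists (block_mx 1%:M A^T (- 1%:M) A) => v.
rewrite -[v]hsubmxK; move: (lsubmx v) (rsubmx v) => {v} x y.
rewrite mul_row_block !mulmx1 mulmxN mulmx1 qmap_hyp qmap_dbl.
rewrite raddfD /= !trmx_mul trmxK mulmxDr !mulmxBl !mulmxA /qmap.
have e : (x *m A^T *m y^T) 0 0 = (y *m A *m x^T) 0 0.
  have -> : x *m A^T *m y^T = (y *m A *m x^T)^T
    by rewrite !trmx_mul trmxK mulmxA.
  by rewrite [LHS]mxE.
have e' : (y *m A^T *m y^T) 0 0 = (y *m A *m y^T) 0 0.
  have -> : y *m A^T *m y^T = (y *m A *m y^T)^T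
    by rewrite !trmx_mul trmxK mulmxA.
  by rewrite [LHS]mxE.
have mE (X Y : 'M[K]_1) : (X + Y) 0 0 = X 0 0 + Y 0 0 by rewrite mxE.
have nE (X : 'M[K]_1) : (- X) 0 0 = - X 0 0 by rewrite mxE.
by rewrite !(mE, nE) e e'; ring.
Qed.

(** If [<<s>> [1, b]] is anisotropic, a zero of its double by a shows [- a] to be a quotient of two
    values, hence a similarity factor, so a may be replaced by -1. A zero of [[1, b]] is a root r
    that factors it as [(p - r q) (p + (r + 1) q)]. *)
Lemma isotropic_pfister s (b : K) : nonzeros s ->
  ~ anisotropic (pfm s (qb b)) ->
  exists n, (n + n)%N = pfd s (1 + 1) /\ emb (pfm s (qb b)) (hyp n).
Proof.
elim: s => [_ isoP|a s IH /=/andP[nz_a nz_s] isoP] /=.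
  exists 1%N; split=> //.
  have [v [qv nz_v]] : exists v, qmap (qb b) v = 0 /\ v <> 0.
    apply: boolp.contrapT => h; apply: isoP => v qv.
    by apply: boolp.contrapT => nz; apply: h; exists v.
  have [x [y Dv]] := vec2P v; rewrite Dv qmap_qb in qv.
  have nz_y : y != 0.
    apply/eqP => y0; case: nz_v; move: qv.
    rewrite Dv y0 mulr0 expr0n mulr0 !addr0 => /eqP;
      rewrite expf_eq0 /= => /eqP ->.
    by rewrite /vec2 raddf0 row_mx0.
  pose r := x / y.
  have qr : r ^+ 2 + r + b = 0.
    apply: (mulIf (expf_neq0 2 nz_y)); rewrite mul0r -qv /r; by field.
  exists (block_mx 1%:M 1%:M (- r)%:M (r + 1)%:M) => u.
  have [p [q ->]] := vec2P u; rewrite vec2M qmap_qb /vec2 qmap_hyp tr_scalar_mx.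
  rewrite -scalar_mxM mxE mulr1n -[LHS]addr0 -(mulr0 (q ^+ 2)) -qr; ring.
have [anP|/(IH nz_s)[n [en hn]]] := boolp.EM (anisotropic (pfm s (qb b))).
  exists (pfd s (1 + 1)); split=> //.
  have [x [y [e nz]]] :
    exists x y, qmap (pfm s (qb b)) x + a * qmap (pfm s (qb b)) y = 0
      /\ qmap (pfm s (qb b)) y != 0.
    apply: boolp.contrapT => h; apply: isoP => v; rewrite qmap_dblE => qv.
    have qy : qmap (pfm s (qb b)) (rsubmx v) = 0.
      by apply/eqP/negPn/negP => nz; apply: h; exists (lsubmx v), (rsubmx v).
    rewrite -[v]hsubmxK (anP _ qy); move: qv; rewrite qy mulr0 addr0 => /anP ->.
    exact: row_mx0.
  have rdP : round (pfm s (qb b)) by apply/round_pfm/round_qb.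
  have ex : - a = qmap (pfm s (qb b)) x / qmap (pfm s (qb b)) y.
    apply: (mulIf nz); rewrite mulfVK // mulNr; apply/eqP.
    by rewrite eq_sym -addr_eq0 e.
  have sim : similar (pfm s (qb b)) (- a)^-1.
    apply: similarV; first by rewrite oppr_eq0.
    rewrite ex; apply: similarM; last exact/similarV/rdP.
    apply: rdP; apply: contraNneq nz_a => x0.
    by rewrite -oppr_eq0 ex x0 mul0r.
  have nz_ia : (- a)^-1 != 0 by rewrite invr_eq0 oppr_eq0.
  apply: emb_trans (emb_dbl_similar a nz_ia sim) _.
  rewrite (_ : a / - a = -1); last by rewrite invrN mulrN divff.
  exact: emb_dbl_opp.
exists (n + n)%N; split; first by rewrite en.
exact: emb_trans (emb_dbl a hn) (emb_dbl_hyp a n).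
Qed.

End Hyperbolic.

(** * Matrix forms and the forms of the statement *)

Section Bridge.
Variable K : fieldType.
Implicit Types (phi psi rho : qform K) (B C : bform K).

Lemma invertible_linear_mx p q (f : {linear 'rV[K]_p -> 'rV[K]_q}) :
  bijective f ->
  exists P Q, [/\ forall v, v *m P = f v, P *m Q = 1%:M & Q *m P = 1%:M].
Proof.
case=> g fK gK; pose P := lin1_mx f; pose Q := \matrix_i g (delta_mx 0 i).
have hP v : v *m P = f v by rewrite mul_rV_lin1.
have QP : Q *m P = 1%:M.
  by apply/row_matrixP => i; rewrite row_mul rowK hP gK row1.
exists P, Q; split=> //; apply/row_matrixP => i.
by apply: (can_inj fK); rewrite -!hP -!row_mul -mulmxA QP mulmx1 mul1mx.
Qed.

Lemma qisometric_emb phi psi : qisometric phi psi ->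
  [/\ qdim phi = qdim psi, emb (qmx phi) (qmx psi) & emb (qmx psi) (qmx phi)].
Proof.
case=> f [/invertible_linear_mx[P [Q [hP PQ QP]]] hf]; split.
- apply/eqP; rewrite eqn_leq -{1}(mxrank1 K (qdim phi)) -PQ
  (leq_trans (mxrankM_maxl _ _) (rank_leq_col _)).
  by rewrite -{1}(mxrank1 K (qdim psi)) -QP (leq_trans (mxrankM_maxl _ _)
    (rank_leq_col _)).
- by exists P => v; rewrite hP; apply: hf.
- exists Q => v; transitivity (qval (f (v *m Q))); first by rewrite hf.
  by rewrite -hP -mulmxA QP mulmx1.
Qed.

Lemma emb_qisometric phi psi : qdim phi = qdim psi -> nondegenerate (qmx phi) ->
  emb (qmx phi) (qmx psi) -> qisometric phi psi.
Proof.
case: phi psi => [p A] [q C] /= e; subst q => ndA [P hP].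
have uP : P \in unitmx by rewrite -row_free_unit; apply: emb_inj ndA hP.
exists (mulmxr P); split; last exact: hP.
by exists (mulmxr (invmx P)) => v /=; rewrite ?mulmxK ?mulmxKV.
Qed.

Lemma entry_delta m n (M : 'M[K]_(m, n)) i j :
  M i j = ((delta_mx 0 i : 'rV_m) *m M *m (delta_mx 0 j : 'rV_n)^T) 0 0.
Proof. by rewrite trmx_delta -rowE -colE !mxE. Qed.

Lemma bisometric_mx B C : bisometric B C -> exists P Q,
  [/\ P *m Q = 1%:M, Q *m P = 1%:M & P *m bmx C *m P^T = bmx B].
Proof.
case=> f [/invertible_linear_mx[P [Q [hP PQ QP]]] hf]; exists P, Q; split=> //.
apply/matrixP => i j; rewrite [LHS]entry_delta [RHS]entry_delta.
by have := hf (delta_mx 0 i) (delta_mx 0 j);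
  rewrite /bval -!hP trmx_mul !mulmxA.
Qed.

Definition alternating N (M : 'M[K]_N) := M^T = - M /\ forall i, M i i = 0.

Lemma qmap_alternating N (M : 'M[K]_N) v : alternating M -> qmap M v = 0.
Proof.
case=> skM diM; pose U := \matrix_(i, j) if (i < j)%N then M i j else 0.
have -> : M = U - U^T.
  apply/matrixP => i j; rewrite !mxE; case: ltngtP => [_|_|/val_inj ->].
  - by rewrite subr0.
  - by have /matrixP/(_ i j) := skM; rewrite !mxE sub0r => ->; rewrite opprK.
  - by rewrite diM subr0.
rewrite /qmap mulmxBr mulmxBl [LHS]mxE [X in _ + X]mxE.
have -> : v *m U^T *m v^T = (v *m U *m v^T)^T by rewrite !trmx_mul trmxK mulmxA.
by rewrite [X in _ - X]mxE subrr.
Qed.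

Lemma alternating_of_qmap N (M : 'M[K]_N) : (forall v, qmap M v = 0) ->
  alternating M.
Proof.
move=> h; have di i j : pmap M (delta_mx 0 i) (delta_mx 0 j) = 0
  by rewrite pmapE !h; ring.
split=> [|i]; last by rewrite entry_delta; apply: h.
apply/matrixP => i j; have := di i j; rewrite /pmap -entry_delta !mxE.
by move/eqP; rewrite addrC addr_eq0 => /eqP.
Qed.

(** A quadratic form fixes its matrix only up to an alternating one; tensoring an alternating matrix
    with a symmetric one gives an alternating matrix, so the ambiguity does no harm. *)
Lemma qtens_congr B C rho psi : bisometric B C -> qisometric rho psi ->
  [/\ qdim (qtens B rho) = qdim (qtens C psi),
      emb (qmx (qtens B rho)) (qmx (qtens C psi))
    & emb (qmx (qtens C psi)) (qmx (qtens B rho))].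
Proof.
move=> /bisometric_mx[P [Q [PQ QP hP]]] /qisometric_emb[e [R hR] [S hS]].
have tens_emb (B1 B2 : bform K) (r1 r2 : qform K) (P1 :
  'M_(bdim B1, bdim B2)) (R1 : 'M_(qdim r1, qdim r2)) :
    P1 *m bmx B2 *m P1^T = bmx B1 -> (forall v, qmap (qmx r2) (v *m R1) =
      qmap (qmx r1) v) ->
  emb (qmx (qtens B1 r1)) (qmx (qtens B2 r2)).
  move=> hP1 hR1; exists (P1 *t R1) => v /=.
  have -> : qmap (bmx B2 *t qmx r2) (v *m (P1 *t R1)) =
      qmap (bmx B1 *t (R1 *m qmx r2 *m R1^T)) v.
    by rewrite -hP1 -!tensmx_mul -trmx_tens /qmap trmx_mul !mulmxA.
  pose M := R1 *m qmx r2 *m R1^T - qmx r1.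
  have altM : alternating M.
    apply: alternating_of_qmap => u;
      rewrite /qmap mulmxBr mulmxBl [LHS]mxE [X in _ + X]mxE.
    by have := hR1 u; rewrite /qmap trmx_mul !mulmxA => ->; rewrite subrr.
  have -> : R1 *m qmx r2 *m R1^T = qmx r1 + M by rewrite /M addrC subrK.
  clearbody M.
  have -> : bmx B1 *t (qmx r1 + M) = bmx B1 *t qmx r1 + bmx B1 *t M.
    by apply/matrixP => i j; rewrite !mxE mulrDr.
  rewrite /qmap mulmxDr mulmxDl [LHS]mxE -/(qmap _ _) -/(qmap (bmx B1 *t M) v).
  rewrite (@qmap_alternating _ (bmx B1 *t M)) ?addr0 //.
  case: altM => skM diM; split=> [|i].
    by rewrite trmx_tens bmx_sym skM; apply/matrixP => i j; rewrite !mxE mulrN.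
  by rewrite !mxE diM mulr0.
split; last 2 first.
- exact: tens_emb hP hR.
- apply: (tens_emb _ _ _ _ Q) hS;
  rewrite -hP !mulmxA QP mul1mx -mulmxA -trmx_mul QP.
  by rewrite trmx1 mulmx1.
rewrite /= e; congr (_ * _)%N.
apply/eqP; rewrite eqn_leq -{1}(mxrank1 K (bdim B)) -PQ
  (leq_trans (mxrankM_maxl _ _) (rank_leq_col _)).
by rewrite -{1}(mxrank1 K (bdim C)) -QP (leq_trans (mxrankM_maxl _ _)
  (rank_leq_col _)).
Qed.

Lemma bisometric_refl B : bisometric B B.
Proof. by exists idfun; split=> //; exists idfun. Qed.

Lemma qisometric_refl phi : qisometric phi phi.
Proof. by exists idfun; split=> //; exists idfun. Qed.

Lemma big_mxtens m n (F : 'I_(m * n) -> K) :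
  \sum_k F k = \sum_i \sum_j F (mxtens_index (i, j)).
Proof.
rewrite pair_big /= (reindex (@mxtens_index m n)) /=.
  by apply: eq_bigr => -[i j].
exists (@mxtens_unindex m n) => k _;
  [exact: mxtens_indexK | exact: mxtens_unindexK].
Qed.

Lemma qmap_sum2 N (M : 'M[K]_N) v : qmap M v =
  \sum_i \sum_j v 0 i * M i j * v 0 j.
Proof.
rewrite qmap_sum exchange_big; apply: eq_bigr => j _.
by rewrite mxE mulr_suml.
Qed.

(** Reassociates the indices of a triple Kronecker product, so that a diagonal left factor becomes
    an orthogonal sum of blocks. *)
Definition slice m n p (a : 'I_m) (q : 'I_(n * p)) : 'I_(m * n * p) :=
  mxtens_index (mxtens_index (a, (mxtens_unindex q).1), (mxtens_unindex q).2).

Lemma big_slice m n p (F : 'I_(m * n * p) -> K) :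
  \sum_k F k = \sum_(a < m) \sum_q F (slice a q).
Proof.
rewrite big_mxtens big_mxtens; apply: eq_bigr => a _.
rewrite [RHS]big_mxtens; apply: eq_bigr => i _; apply: eq_bigr => j _.
by rewrite /slice mxtens_indexK.
Qed.

Lemma tens_slice m n p (D : 'M[K]_m) (B : 'M[K]_n) (X : 'M[K]_p) a b q q' :
  ((D *t B) *t X) (slice a q) (slice b q') = D a b * (B *t X) q q'.
Proof. by rewrite /slice !tensmxE [(B *t X) _ _]mxE mulrA. Qed.

Lemma qmap_tens_diag a n p (B : 'M[K]_n) (X : 'M[K]_p) v :
  qmap (((bmx (bdiag [:: 1; a]) : 'M_2) *t B) *t X) v =
  qmap (B *t X) (colsub (@slice 2 n p 0) v) +
  a * qmap (B *t X) (colsub (@slice 2 n p 1) v).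
Proof.
rewrite !qmap_sum2 big_slice big_ord_recl big_ord1 mulr_sumr.
congr (_ + _); apply: eq_bigr => q _; rewrite big_slice big_ord_recl big_ord1.
  rewrite [X in _ + X]big1 ?addr0 => [|q' _].
    by apply: eq_bigr => q' _; rewrite tens_slice !mxE /= mulr1n mul1r.
  by rewrite tens_slice !mxE /= mulr0n !(mul0r, mulr0).
rewrite [X in X + _]big1 ?add0r ?mulr_sumr => [|q' _].
  apply: eq_bigr => q' _; rewrite tens_slice !mxE /= mulr1n.
  have -> : lift ord0 ord0 = 1 :> 'I_2 by apply: val_inj.
  ring.
by rewrite tens_slice !mxE /= mulr0n !(mul0r, mulr0).
Qed.

Lemma emb_tens_diag a n p (B : 'M[K]_n) (X : 'M[K]_p) :
  emb (dbl a (B *t X)) (((bmx (bdiag [:: 1; a]) : 'M_2) *t B) *t X).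
Proof.
pose f (k : 'I_(2 * n * p)) : 'I_(n * p + n * p) :=
  let ij := mxtens_unindex (mxtens_unindex k).1 in
  let q := mxtens_index (ij.2, (mxtens_unindex k).2) in
  if ij.1 == 0 then lshift _ q else rshift _ q.
exists (colsub f 1%:M) => v; rewrite mulmx_colsub mulmx1 qmap_tens_diag.
rewrite qmap_dblE.
have fE (b : 'I_2) q :
  f (slice b q) = if b == 0 then lshift _ q else rshift _ q.
  by rewrite -(mxtens_unindexK q); case: (mxtens_unindex q) => i j;
    rewrite /f /slice !mxtens_indexK.
have -> : colsub (@slice 2 n p 0) (colsub f v) = lsubmx v.
  by apply/rowP => q; rewrite !mxE fE.
have -> // : colsub (@slice 2 n p 1) (colsub f v) = rsubmx v.
by apply/rowP => q; rewrite !mxE fE.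
Qed.

Lemma emb_pfm_qtens s rho :
  emb (pfm s (qmx rho)) (qmx (qtens (bpf s) rho)).
Proof.
elim: s => [|a s IH] /=;
  last exact: emb_trans (emb_dbl a IH) (emb_tens_diag _ _ _).
pose f (k : 'I_(1 * qdim rho)) := (mxtens_unindex k).2.
exists (colsub f 1%:M) => v; rewrite mulmx_colsub mulmx1 !qmap_sum2.
rewrite big_mxtens big_ord1; apply: eq_bigr => i _.
rewrite big_mxtens big_ord1; apply: eq_bigr => j _.
by rewrite tensmxE !mxE /f !mxtens_indexK /= mulr1n mul1r.
Qed.

Lemma qdim_qtens s rho : qdim (qtens (bpf s) rho) = pfd s (qdim rho).
Proof.
rewrite pfdE /=; congr (_ * _)%N.
by elim: s => //= a s ->; rewrite expnS.
Qed.

Lemma emb_hyp_iter n :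
  emb (hyp K n) (qmx (iter n (qadd (hplane K)) (qzero K))).
Proof.
elim: n => [|n [P hP]].
  by exists 0 => v; rewrite [v]thinmx0 mul0mx !qmap0.
have hQ (a : 'rV_(1 + 1)) b :
  qmap (qmx (iter n.+1 (qadd (hplane K)) (qzero K))) (row_mx a b) =
    qmap (hyp K 1) a + qmap (qmx (iter n (qadd (hplane K)) (qzero K))) b.
  exact: qval_qadd.
pose M : 'M_((1 + n) + (1 + n), (1 + 1) + _) :=
  col_mx (col_mx (row_mx (row_mx 1%:M (0 : 'M_1)) 0) (row_mx 0 (usubmx P)))
         (col_mx (row_mx (row_mx (0 : 'M_1) 1%:M) 0) (row_mx 0 (dsubmx P))).
have hM (x0 y0 : 'M_1) (x1 y1 : 'rV_n) :
    row_mx (row_mx x0 x1) (row_mx y0 y1) *m M =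
      row_mx (row_mx x0 y0) (row_mx x1 y1 *m P).
  rewrite -[P in RHS]vsubmxK /M !mul_row_col !mul_mx_row !mulmx0 !mulmx1
    !add_row_mx.
  by rewrite !(addr0, add0r) add_row_mx addr0 add0r.
exists M => v; rewrite -[v](@hsubmxK _ _ (1 + n) (1 + n)).
move: (lsubmx (v : 'rV_((1 + n) + (1 + n)))) (rsubmx (v :
  'rV_((1 + n) + (1 + n)))) => x y.
rewrite -[x](@hsubmxK _ _ 1 n) -[y](@hsubmxK _ _ 1 n) hM hQ hP (qmap_hyp (n :=
  1 + n)) !qmap_hyp.
by rewrite tr_row_mx mul_row_col [RHS]mxE.
Qed.

Lemma hyperbolic_of_emb phi n : qdim phi = (n + n)%N ->
  nondegenerate (qmx phi) ->
  emb (qmx phi) (hyp K n) -> hyperbolic phi.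
Proof.
move=> e nd h; exists n; apply: emb_qisometric nd _;
  last exact: emb_trans h (emb_hyp_iter n).
by rewrite e; elim: n {e h} => //= n <-; rewrite addSn addnS.
Qed.

Lemma anisotropic_nonhyperbolic phi : (0 < qdim phi)%N ->
  anisotropic (qmx phi) ->
  ~ hyperbolic phi.
Proof.
move=> d_gt0 anP [k /qisometric_emb[e _ [P hP]]].
case: k => [|k] in P hP e *; first by rewrite e in d_gt0.
have hQ (a : 'rV_(1 + 1)) b :
  qmap (qmx (iter k.+1 (qadd (hplane K)) (qzero K))) (row_mx a b) =
    qmap (hyp K 1) a + qmap (qmx (iter k (qadd (hplane K)) (qzero K))) b.
  exact: qval_qadd.
pose d := qdim (iter k (qadd (hplane K)) (qzero K)).
pose w : 'rV[K]_((1 + 1) + d) := row_mx (vec2 1 0) 0.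
pose w' : 'rV[K]_((1 + 1) + d) := row_mx (vec2 0 1) 0.
have qw x y : qmap (hyp K 1) (vec2 x y) = x * y.
  by rewrite qmap_hyp tr_scalar_mx -scalar_mxM mxE mulr1n.
have := isom_pmap1 hP w w'.
have -> : w *m P = 0 by apply: anP; rewrite hP hQ qw qmap0 mulr0 addr0.
rewrite pmap0l pmapE add_row_mx vec2D !hQ !qw addr0 !qmap0 => /esym/eqP.
by rewrite !(addr0, add0r, mulr0, mul0r, mulr1,
  subr0) qmap0 addr0 (negPf (oner_neq0 K)).
Qed.

End Bridge.

(** * Closure under solutions of embedding problems *)

Local Open Scope classical_set_scope.
Local Open Scope ring_scope.

(* A quotient of a set X of names, given partial evaluations of the names in  *)
(* fields L t which are compatible with the operations for almost all t.      *)
Section UltraQuotient.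
Variables (T : Type) (U : set_system T).
Hypothesis ultraU : UltraFilter U.
Variables (L : T -> fieldType) (X : choiceType) (ev : forall t, X -> L t).
Variables (zero one : X) (opp inv : X -> X) (add mul : X -> X -> X).
Hypothesis ev0 : U [set t | ev t zero = 0].
Hypothesis ev1 : U [set t | ev t one = 1].
Hypothesis evN : forall x, U [set t | ev t (opp x) = - ev t x].
Hypothesis evV : forall x, U [set t | ev t (inv x) = (ev t x)^-1].
Hypothesis evD : forall x y, U [set t | ev t (add x y) = ev t x + ev t y].
Hypothesis evM : forall x y, U [set t | ev t (mul x y) = ev t x * ev t y].

Definition ueqv x y := U [set t | ev t x = ev t y].

Lemma ueqv_refl x : ueqv x x.
Proof. by apply: filterS filterT => t _. Qed.

Lemma ueqv_sym x y : ueqv x y -> ueqv y x.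
Proof. by apply: filterS => t. Qed.

Lemma ueqv_trans x y z : ueqv x y -> ueqv y z -> ueqv x z.
Proof. by apply: filterS2 => t /= -> ->. Qed.

Definition urep x := choose (fun y => `[< ueqv x y >]) x.

Lemma urepP x : ueqv x (urep x).
Proof. by apply/asboolP/(chooseP (P := fun y =>
  `[< ueqv x y >]))/asboolP/ueqv_refl. Qed.

Lemma urep_eq x y : ueqv x y -> urep x = urep y.
Proof.
move=> xy; rewrite /urep;
  have e : (fun z => `[< ueqv x z >]) =1 (fun z => `[< ueqv y z >]).
  move=> z; apply/asbool_equiv_eq; split; first exact/ueqv_trans/ueqv_sym.
  exact: ueqv_trans.
rewrite (eq_choose e) (choose_id (y0 := y)) //; apply/asboolP;
  last exact: ueqv_refl.
exact: ueqv_sym.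
Qed.

Lemma urep_id x : urep (urep x) == urep x.
Proof. by apply/eqP/urep_eq/ueqv_sym/urepP. Qed.

Definition uquo := {x : X | urep x == x}.
HB.instance Definition _ := Choice.on uquo.

Implicit Types k l : uquo.

Definition uval k : X := sval k.

Definition upi x : uquo := exist _ (urep x) (urep_id x).
Definition uev t (k : uquo) : L t := ev t (uval k).

Lemma uev_pi x : U [set t | uev t (upi x) = ev t x].
Proof. exact/ueqv_sym/urepP. Qed.

Lemma uquo_eq (k l : uquo) : U [set t | uev t k = uev t l] -> k = l.
Proof.
move=> /urep_eq; rewrite /uval (eqP (svalP k)) (eqP (svalP l)) => e.
exact: (@val_inj _ (fun x => urep x == x)).
Qed.

Definition uadd k l := upi (add (uval k) (uval l)).
Definition umul k l := upi (mul (uval k) (uval l)).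
Definition uopp k := upi (opp (uval k)).
Definition uinv k := upi (inv (uval k)).

Lemma uevD k l : U [set t | uev t (uadd k l) = uev t k + uev t l].
Proof. by apply: filterS2 (uev_pi (add (uval k) (uval l)))
  (evD (uval k) (uval l)) => t /= ->. Qed.
Lemma uevM k l : U [set t | uev t (umul k l) = uev t k * uev t l].
Proof. by apply: filterS2 (uev_pi (mul (uval k) (uval l)))
  (evM (uval k) (uval l)) => t /= ->. Qed.
Lemma uevN k : U [set t | uev t (uopp k) = - uev t k].
Proof. by apply: filterS2 (uev_pi (opp (uval k))) (evN (uval k)) =>
  t /= ->. Qed.
Lemma uevV k : U [set t | uev t (uinv k) = (uev t k)^-1].
Proof. by apply: filterS2 (uev_pi (inv (uval k))) (evV (uval k)) =>
  t /= ->. Qed.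
Lemma uev0 : U [set t | uev t (upi zero) = 0].
Proof. by apply: filterS2 (uev_pi zero) ev0 => t /= ->. Qed.
Lemma uev1 : U [set t | uev t (upi one) = 1].
Proof. by apply: filterS2 (uev_pi one) ev1 => t /= ->. Qed.

Lemma uaddA : associative uadd.
Proof.
move=> x y z; apply: uquo_eq.
apply: filterS (filterI (filterI (uevD x (uadd y z)) (uevD y z))
                        (filterI (uevD (uadd x y) z) (uevD x y))) => t /=.
by case=> -[-> ->] [-> ->]; rewrite addrA.
Qed.

Lemma uaddC : commutative uadd.
Proof.
move=> x y; apply: uquo_eq; apply: filterS2 (uevD x y) (uevD y x) => t /= -> ->.
exact: addrC.
Qed.

Lemma uadd0 : left_id (upi zero) uadd.
Proof.
move=> x; apply: uquo_eq; apply: filterS2 (uevD (upi zero) x) uev0 => t /= ->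
  ->.
exact: add0r.
Qed.

Lemma uaddN : left_inverse (upi zero) uopp uadd.
Proof.
move=> x; apply: uquo_eq.
apply: filterS3 (uevD (uopp x) x) uev0 (uevN x) => t /= -> -> ->.
exact: addNr.
Qed.

HB.instance Definition _ := GRing.isZmodule.Build uquo uaddA uaddC uadd0 uaddN.

Lemma umulA : associative umul.
Proof.
move=> x y z; apply: uquo_eq.
apply: filterS (filterI (filterI (uevM x (umul y z)) (uevM y z))
                        (filterI (uevM (umul x y) z) (uevM x y))) => t /=.
by case=> -[-> ->] [-> ->]; rewrite mulrA.
Qed.

Lemma umulC : commutative umul.
Proof.
move=> x y; apply: uquo_eq; apply: filterS2 (uevM x y) (uevM y x) => t /= -> ->.
exact: mulrC.
Qed.

Lemma umul1 : left_id (upi one) umul.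
Proof.
move=> x; apply: uquo_eq; apply: filterS2 (uevM (upi one) x) uev1 => t /= -> ->.
exact: mul1r.
Qed.

Lemma umulDl : left_distributive umul uadd.
Proof.
move=> x y z; apply: uquo_eq.
apply: filterS (filterI (filterI (uevM (uadd x y) z) (uevD x y))
    (filterI (uevD (umul x z) (umul y z)) (filterI (uevM x z) (uevM y z)))) =>
      t /=.
by case=> -[-> ->] [-> [-> ->]]; rewrite mulrDl.
Qed.

Lemma uone_neq0 : upi one != upi zero.
Proof.
have /filter_ex[t [/= e0 e1]] :
    U ([set t | uev t (upi zero) = 0] `&` [set t | uev t (upi one) = 1]).
  by apply: filterI; [apply: uev0|apply: uev1].
by apply/eqP => e; move/eqP: e1; rewrite e e0 eq_sym oner_eq0.
Qed.

HB.instance Definition _ :=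
  GRing.Zmodule_isComNzRing.Build uquo umulA umulC umul1 umulDl uone_neq0.

Lemma uev_neq0 (k : uquo) : k != 0 -> U [set t | uev t k <> 0].
Proof.
move=> /eqP nz; have [z|//] := in_ultra_setVsetC [set t | uev t k = 0] ultraU.
by case: nz; apply: uquo_eq; apply: filterS2 z uev0 => t /= -> ->.
Qed.

Lemma umulV (k : uquo) : k != 0 -> uinv k * k = 1.
Proof.
move=> /uev_neq0 nz; apply: uquo_eq.
apply: filterS (filterI (filterI (uevM (uinv k) k) (uevV k))
  (filterI uev1 nz)) => t /=.
by case=> -[-> ->] [-> /eqP h]; rewrite mulVf.
Qed.

Lemma uinv0 : uinv 0 = 0.
Proof.
apply: uquo_eq; apply: filterS2 (uevV 0) uev0 => t /= -> ->.
exact: invr0.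
Qed.

HB.instance Definition _ := GRing.ComNzRing_isField.Build uquo umulV uinv0.

Definition uquo_field : fieldType := uquo.

Lemma uev_add (x y : uquo_field) :
  U [set t | uev t (x + y) = uev t x + uev t y].
Proof. exact: uevD. Qed.

Lemma uev_mul (x y : uquo_field) :
  U [set t | uev t (x * y) = uev t x * uev t y].
Proof. exact: uevM. Qed.

Variables (F : fieldType) (i : forall t, {rmorphism F -> L t}) (cst : F -> X).
Hypothesis ev_cst : forall c, U [set t | ev t (cst c) = i t c].

Definition ucst c : uquo_field := upi (cst c).

Lemma uev_cst c : U [set t | uev t (ucst c) = i t c].
Proof. by apply: filterS2 (uev_pi (cst c)) (ev_cst c) => t /= ->. Qed.

Lemma ucst_zmod_morphism : zmod_morphism ucst.
Proof.
move=> x y; apply: uquo_eq.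
apply: filterS (filterI (filterI (uev_cst (x - y)) (uevD (ucst x) (- ucst y)))
    (filterI (uev_cst x) (filterI (uev_cst y) (uevN (ucst y))))) => t /=.
by case=> -[-> ->] [-> [+ ->]] => ->; rewrite rmorphB.
Qed.

Lemma ucst_monoid_morphism : monoid_morphism ucst.
Proof.
split; first by apply: uquo_eq; apply: filterS2 (uev_cst 1) uev1 => t /= -> ->;
  rewrite rmorph1.
move=> x y; apply: uquo_eq.
apply: filterS (filterI (filterI (uev_cst (x * y)) (uevM (ucst x) (ucst y)))
    (filterI (uev_cst x) (uev_cst y))) => t /=.
by case=> -[-> ->] [-> ->]; rewrite rmorphM.
Qed.

HB.instance Definition _ :=
  GRing.isZmodMorphism.Build F uquo_field ucst ucst_zmod_morphism.
HB.instance Definition _ :=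
  GRing.isMonoidMorphism.Build F uquo_field ucst ucst_monoid_morphism.

Definition ucst_rmorphism : {rmorphism F -> uquo_field} := ucst.

End UltraQuotient.

(** A substitute for the theorem of Los: each instance of a law holds for almost all t, though no
    single [e t] need be a morphism. *)
Definition near_embedding (F K : fieldType) (k : {rmorphism F -> K}) T
    (U : set_system T) (L : T -> fieldType) (i : forall t, {rmorphism F -> L t})
    (e : forall t, K -> L t) :=
  [/\ forall x y, U [set t | e t (x + y) = e t x + e t y],
      forall x y, U [set t | e t (x * y) = e t x * e t y],
      forall c, U [set t | e t (k c) = i t c]
    & forall x, x != 0 -> U [set t | e t x <> 0]].

(** * A field in which every problem has a solution *)

Section Closure.
Variables (F : fieldType) (I : Type) (ar : I -> nat) (D : nat).

(* wit p d j names the j-th coordinate of a solution to problem p with data d *)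
Inductive term :=
| Const of F
| Add of term & term
| Mul of term & term
| Opp of term
| Inv of term
| Wit (p : I) of ('I_(ar p) -> 'I_D -> term) & 'I_D.

HB.instance Definition _ := gen_eqMixin term.
HB.instance Definition _ := gen_choiceMixin term.

Variable good : forall L : fieldType, {rmorphism F -> L} -> Prop.
Variable sol : forall (p : I) (L : fieldType),
  {rmorphism F -> L} -> 'M[L]_(ar p, D) -> 'rV[L]_D -> Prop.
Arguments good {L}.
Arguments sol p {L}.

Hypothesis D_gt0 : (0 < D)%N.
Hypothesis good0 : exists (L : fieldType) (i : {rmorphism F -> L}), good i.
Hypothesis sol_map : forall p (L M : fieldType) (i : {rmorphism F -> L})
    (h : {rmorphism L -> M}) (g : {rmorphism F -> M}) d s,
  (forall x, g x = h (i x)) -> sol p i d s -> sol p g (map_mx h d) (map_mx h s).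
Hypothesis sol_ex : forall p (L : fieldType) (i : {rmorphism F -> L}) d,
  good i ->
  exists (M : fieldType) (h : {rmorphism L -> M}),
    good (h \o i) /\ exists s, sol p (h \o i) (map_mx h d) s.
Hypothesis good_near : forall (K : fieldType) (k : {rmorphism F -> K}) T
    (U : set_system T) (L : T -> fieldType) (i :
      forall t, {rmorphism F -> L t}) e,
  ProperFilter U -> near_embedding k U i e -> (forall t, good (i t)) -> good k.
Hypothesis sol_near : forall (K : fieldType) (k : {rmorphism F -> K}) T
    (U : set_system T) (L : T -> fieldType) (i :
      forall t, {rmorphism F -> L t}) e p d s,
  ProperFilter U -> near_embedding k U i e ->
  U [set t | sol p (i t) (map_mx (e t) d) (map_mx (e t) s)] -> sol p k d s.

(** The coordinates of a solution enter the domain together, since [sol] constrains the whole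
    vector. *)
Definition coherent_at (L : fieldType) (i : {rmorphism F -> L})
    (dom : term -> Prop) (ev : term -> L) (t : term) : Prop :=
  match t with
  | Const x => ev t = i x
  | Add a b => [/\ dom a, dom b & ev t = ev a + ev b]
  | Mul a b => [/\ dom a, dom b & ev t = ev a * ev b]
  | Opp a => dom a /\ ev t = - ev a
  | Inv a => dom a /\ ev t = (ev a)^-1
  | Wit p d _ => [/\ forall x y, dom (d x y), forall j, dom (Wit d j)
      & sol p i (\matrix_(x, y) ev (d x y)) (\row_j ev (Wit d j))]
  end.

(** A stage of the construction: a good field in which a set of names, closed under subterms, is
    interpreted. *)
Record state := State {
  st_field : fieldType;
  st_map : {rmorphism F -> st_field};
  st_good : good st_map;
  st_dom : term -> Prop;
  st_ev : term -> st_field;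
  st_coh : forall t, st_dom t -> coherent_at st_map st_dom st_ev t }.

Definition st_le s s' := exists h : {rmorphism st_field s -> st_field s'},
  forall t, st_dom s t -> st_dom s' t /\ st_ev s' t = h (st_ev s t).

Lemma st_le_refl s : st_le s s.
Proof. by exists idfun. Qed.

Lemma st_le_trans s1 s2 s3 : st_le s1 s2 -> st_le s2 s3 -> st_le s1 s3.
Proof.
move=> [h hP] [g gP]; exists (g \o h) => t /hP[/gP[? ->] ->]; by [].
Qed.

Lemma st_extend s (M : fieldType) (h : {rmorphism st_field s -> M})
    (g : {rmorphism F -> M}) (new : term -> Prop) (v : term -> M) :
    (forall x, g x = h (st_map s x)) -> good g ->
    (forall t, new t -> ~ st_dom s t) ->
    let dom t := st_dom s t \/ new t in
    (forall ev : term -> M, (forall t, st_dom s t -> ev t = h (st_ev s t)) ->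
       (forall t, new t -> ev t = v t) ->
     forall t, new t -> coherent_at g dom ev t) ->
  exists s', st_le s s' /\ forall t, new t -> st_dom s' t.
Proof.
move=> gE gh disj dom hcoh.
pose ev t := if `[< st_dom s t >] then h (st_ev s t) else v t.
have evd t : st_dom s t -> ev t = h (st_ev s t) by rewrite /ev; case: asboolP.
have evn t : new t -> ev t = v t by move=> /disj; rewrite /ev; case: asboolP.
have coh t : dom t -> coherent_at g dom ev t.
  case; last exact: hcoh.
  move=> ts; have := st_coh ts; case: t ts => [x|a b|a b|a|a|p d j] ts /=.
  - by rewrite evd // gE => ->.
  - by case=> da db e; split; [left|left|]; rewrite // !evd // e rmorphD.
  - by case=> da db e; split; [left|left|]; rewrite // !evd // e rmorphM.
  - by case=> da e; split; [left|]; rewrite // !evd // e rmorphN.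
  - by case=> da e; split; [left|]; rewrite // !evd // e fmorphV.
  case=> dd dw /(sol_map gE) e; split; [by left|by left|].
  have -> : \matrix_(x, y) ev (d x y) =
    map_mx h (\matrix_(x, y) st_ev s (d x y)).
    by apply/matrixP => x y; rewrite !mxE evd.
  have -> // : \row_y ev (Wit d y) = map_mx h (\row_y st_ev s (Wit d y)).
  by apply/rowP => y; rewrite !mxE evd.
exists (State gh coh); split=> [|t]; last by right.
by exists h => t ts; split; [left | apply: evd].
Qed.

Definition addable t := forall s, exists s', st_le s s' /\ st_dom s' t.

Lemma addable_fin (X : finType) (f : X -> term) : (forall x, addable (f x)) ->
  forall s, exists s', st_le s s' /\ forall x, st_dom s' (f x).
Proof.
move=> af s; suff [s' [ss' hs']] : exists s', st_le s s' /\
  forall x, x \in enum X -> st_dom s' (f x).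
  by exists s'; split=> // x; apply: hs'; rewrite mem_enum.
elim: (enum X) s => [|x e IH] s; first by exists s; split=> //;
  apply: st_le_refl.
have [s1 [ss1 d1]] := af x s; have [s2 [s12 d2]] := IH s1.
exists s2; split=> [|y]; first exact: st_le_trans ss1 s12.
rewrite inE => /predU1P[->|/d2//].
by case: s12 => h /(_ _ d1)[].
Qed.

Lemma addable_simple t (sub : term -> Prop) (val : forall s, term ->
  st_field s) :
    (forall s, exists s', st_le s s' /\ forall u, sub u -> st_dom s' u) ->
    (forall s, (forall u, sub u -> st_dom s u) -> ~ st_dom s t ->
      forall ev, (forall u, st_dom s u -> ev u = st_ev s u) ->
      ev t = val s t ->
      coherent_at (st_map s) (fun u => st_dom s u \/ u = t) ev t) ->
  addable t.
Proof.
move=> hsub hcoh s; have [s1 [ss1 d1]] := hsub s.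
have [dt|ndt] := EM (st_dom s1 t); first by exists s1.
have [|||s2 [s12 d2]] := @st_extend s1 _ idfun (st_map s1) (fun u => u =
  t) (val s1) (fun=> erefl).
- exact: st_good.
- by move=> _ ->.
- move=> ev evd evt _ ->; apply: hcoh => //; exact: evt.
by exists s2; split; [apply: st_le_trans ss1 s12 | apply: d2].
Qed.

(** Arithmetic terms are evaluated in the field at hand; only a [Wit] term enlarges it, by
    [sol_ex]. *)
Lemma addable_term t : addable t.
Proof.
have le_dom s s' u : st_le s s' -> st_dom s u -> st_dom s' u
  by move=> [h /[apply] -[]].
elim: t => [x|a IHa b IHb|a IHa b IHb|a IHa|a IHa|p d IHd j].
- apply: (@addable_simple _ (fun=> False) (fun s _ => st_map s x)) =>
  [s|s _ _ ev _ e]; last exact: e.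
  by exists s; split=> //; apply: st_le_refl.
- apply: (@addable_simple _ (fun u => u = a \/ u = b) (fun s _ =>
  st_ev s a + st_ev s b)).
    move=> s; have [s1 [l1 d1]] := IHa s; have [s2 [l2 d2]] := IHb s1.
    exists s2; split=> [|u [->|->]//]; first exact: st_le_trans l1 l2.
    exact: le_dom d1.
  move=> s ds _ ev evd evt; split;
    [by left; apply: ds; left|by left; apply: ds; right|rewrite evt].
  by rewrite !evd //; apply: ds; [right|left].
- apply: (@addable_simple _ (fun u => u = a \/ u = b) (fun s _ =>
  st_ev s a * st_ev s b)).
    move=> s; have [s1 [l1 d1]] := IHa s; have [s2 [l2 d2]] := IHb s1.
    exists s2; split=> [|u [->|->]//]; first exact: st_le_trans l1 l2.
    exact: le_dom d1.
  move=> s ds _ ev evd evt; split;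
    [by left; apply: ds; left|by left; apply: ds; right|rewrite evt].
  by rewrite !evd //; apply: ds; [right|left].
- apply: (@addable_simple _ (fun u => u = a) (fun s _ => - st_ev s a)).
    by move=> s; have [s1 [l1 d1]] := IHa s; exists s1; split=> // u ->.
  by move=> s ds _ ev evd evt; split;
    [left; apply: ds|rewrite evt evd //; apply: ds].
- apply: (@addable_simple _ (fun u => u = a) (fun s _ => (st_ev s a)^-1)).
    by move=> s; have [s1 [l1 d1]] := IHa s; exists s1; split=> // u ->.
  by move=> s ds _ ev evd evt; split;
    [left; apply: ds|rewrite evt evd //; apply: ds].
move=> s; have [|s1 [l1 d1]] := @addable_fin _ (fun xy => d xy.1 xy.2) _ s.
  by case=> x y; apply: IHd.
have [dt|ndt] := EM (st_dom s1 (Wit d j)); first by exists s1.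
have [M [h [gh [w hw]]]] := @sol_ex p _ _ (\matrix_(x, y) st_ev s1 (d x y))
  (st_good s1).
pose v (u : term) : M := if u is Wit _ _ j' then w 0 j' else 0.
have [||s2 [l2 d2]] := @st_extend s1 M h (h \o st_map s1) (fun u =>
  exists j', u = Wit d j') v (fun=> erefl) gh.
(* By coherence, one named coordinate of this solution would bring all of them, among them
   [Wit d j]. *)
- move=> _ [j' ->] dj'; case: ndt; have /= [_ + _] := st_coh dj'.
  exact.
- move=> ev evd evn _ [j' ->]; split=> [x y|j''|]; [|by right; exists j''|].
    by left; apply: (d1 (x, y)).
  have -> : \matrix_(x, y) ev (d x y) =
    map_mx h (\matrix_(x, y) st_ev s1 (d x y)).
    by apply/matrixP => x y; rewrite !mxE evd //; apply: (d1 (x, y)).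
  have -> // : \row_y ev (Wit d y) = w.
  by apply/rowP => y; rewrite !mxE evn //; exists y.
by exists s2; split; [apply: st_le_trans l1 l2 | apply: d2; exists j].
Qed.

Lemma state_of_seq (l : seq term) : exists s, forall t, t \in l -> st_dom s t.
Proof.
have [L [i gi]] := good0.
have coh t : False -> coherent_at i (fun=> False) (fun=> 0) t by [].
pose s0 := State gi coh.
elim: l => [|t l [s ds]]; first by exists s0.
have [s' [[h hP] dt]] := addable_term t s; exists s' => u.
by rewrite inE => /predU1P[->//|/ds/hP[]].
Qed.

(** Every finite list of names is interpreted in some good field, so the quotient of all names along
    an ultrafilter on finite lists is a field. Data in this field are represented by names, and the
    corresponding [Wit] names represent a solution. *)
Lemma closure_field : exists (K : fieldType) (k : {rmorphism F -> K}),
  good k /\ forall p d, exists s, sol p k d s.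
Proof.
have [st stP] := choice state_of_seq.
(* The filter generated by the lists containing a given finite list: each name is interpreted at
   almost every list. *)
pose U0 : set_system (seq term) :=
  fun A => exists l0 : seq term, forall l : seq term, {subset l0 <= l} -> A l.
have PU0 : ProperFilter U0.
  split; first by case=> l0 /(_ l0); apply.
  split=> [|A B [l1 h1] [l2 h2]|A B AB [l0 h]]; first by exists [::].
    exists (l1 ++ l2) => l sl; split; [apply: h1|apply: h2] => t tl;
      by apply: sl; rewrite mem_cat tl ?orbT.
  by exists l0 => l /h/AB.
have [U [uU sU]] := ultraFilterLemma PU0.
have Udom t : U [set l | st_dom (st l) t].
  apply: sU; exists [:: t] => l sl; apply: stP; apply: sl; exact: mem_head.
have Ucoh t :
  U [set l | coherent_at (st_map (st l)) (st_dom (st l)) (st_ev (st l)) t].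
  by apply: filterS (Udom t) => l; apply: st_coh.
pose L l := st_field (st l); pose ev l : term -> L l := st_ev (st l).
have evC c : U [set l | ev l (Const c) = st_map (st l) c]
  by apply: filterS (Ucoh (Const c)) => l.
have ev0 : U [set l | ev l (Const 0) = 0] by apply: filterS (evC 0) => l /= ->;
  rewrite rmorph0.
have ev1 : U [set l | ev l (Const 1) = 1] by apply: filterS (evC 1) => l /= ->;
  rewrite rmorph1.
have evN x : U [set l | ev l (Opp x) = - ev l x]
  by apply: filterS (Ucoh (Opp x)) => l [].
have evV x : U [set l | ev l (Inv x) = (ev l x)^-1]
  by apply: filterS (Ucoh (Inv x)) => l [].
have evD x y : U [set l | ev l (Add x y) = ev l x + ev l y]
  by apply: filterS (Ucoh (Add x y)) => l [].
have evM x y : U [set l | ev l (Mul x y) = ev l x * ev l y]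
  by apply: filterS (Ucoh (Mul x y)) => l [].
pose K := uquo_field uU ev0 ev1 evN evV evD evM.
pose k : {rmorphism F -> K} := ucst_rmorphism uU ev0 ev1 evN evV evD evM evC.
pose e l : K -> L l := @uev _ _ _ _ ev l.
have kU : near_embedding k U (fun l => st_map (st l)) e.
  split=> [x y|x y|c|x].
  - exact: uev_add.
  - exact: uev_mul.
  - exact: uev_cst.
  - exact: uev_neq0.
exists K, k; split=> [|p d].
  by apply: good_near kU _ => l; apply: st_good.
pose dt x y := uval (d x y); pose w j : K := upi uU ev (Wit dt j).
exists (\row_j w j); apply: sol_near kU _.
have Uw : U [set l | forall j, e l (w j) = ev l (Wit dt j)].
  have : forall s :
    seq 'I_D, U [set l | forall j, j \in s -> e l (w j) = ev l (Wit dt j)].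
    elim=> [|j s IH]; first by apply: filterS filterT.
    apply: filterS2 IH (uev_pi uU ev (Wit dt j)) => l /= h ej j'.
    by rewrite inE => /predU1P[->|/h].
  by move/(_ (enum 'I_D)); apply: filterS => l /= h j; apply: h;
    rewrite mem_enum.
(* Coherence at any one coordinate yields [sol] for the whole vector; [D_gt0] provides a
   coordinate. *)
pose j0 := Ordinal D_gt0.
apply: filterS2 Uw (Ucoh (Wit dt j0)) => l /= hw [_ _].
congr (sol _ _ _); first by apply/matrixP => x y; rewrite !mxE.
by apply/rowP => j; rewrite !mxE hw.
Qed.

End Closure.

(** * Embedding problems between linked forms *)

Section NearMatrices.
Variables (F K : fieldType) (k : {rmorphism F -> K}) (T : Type) (U :
  set_system T).
Variables (L : T -> fieldType) (i : forall t, {rmorphism F -> L t}).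
Variable e : forall t, K -> L t.
Hypotheses (pU : ProperFilter U) (emb_e : near_embedding k U i e).

Lemma near_all_fin (X : finType) (P : X -> T -> Prop) :
  (forall x, U [set t | P x t]) -> U [set t | forall x, P x t].
Proof.
move=> h; suff : U [set t | forall x, x \in enum X -> P x t].
  by apply: filterS => t /= ht x; apply: ht; rewrite mem_enum.
elim: (enum X) => [|x s IH]; first by apply: filterS filterT.
apply: filterS2 IH (h x) => t /= hs hx y.
by rewrite inE => /predU1P[->|/hs].
Qed.

Lemma near_e0 : U [set t | e t 0 = 0].
Proof.
have [_ _ hc _] := emb_e; have := hc 0; rewrite rmorph0.
by apply: filterS => t /= ->; rewrite rmorph0.
Qed.

Lemma near_sum (J : finType) (f : J -> K) :
  U [set t | e t (\sum_j f j) = \sum_j e t (f j)].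
Proof.
have [hD _ _ _] := emb_e; elim: (index_enum J) => [|j s IH].
  by apply: filterS near_e0 => t /= e0; rewrite !big_nil.
apply: filterS2 IH (hD (f j) (\sum_(j <- s) f j)) => t /= h1 h2.
by rewrite !big_cons h2 h1.
Qed.

Lemma near_mulmx m n p (X : 'M[K]_(m, n)) (Y : 'M[K]_(n, p)) :
  U [set t | map_mx (e t) (X *m Y) = map_mx (e t) X *m map_mx (e t) Y].
Proof.
have [_ hM _ _] := emb_e.
have h1 : U [set t | forall xy : 'I_m * 'I_p,
    e t (\sum_j X xy.1 j * Y j xy.2) = \sum_j e t (X xy.1 j * Y j xy.2)].
  by apply: near_all_fin => xy; apply: near_sum.
have h2 : U [set t | forall xyz : 'I_m * 'I_p * 'I_n,
    e t (X xyz.1.1 xyz.2 * Y xyz.2 xyz.1.2) =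
      e t (X xyz.1.1 xyz.2) * e t (Y xyz.2 xyz.1.2)].
  by apply: near_all_fin => xyz; apply: hM.
apply: filterS2 h1 h2 => t /= h1 h2; apply/matrixP => x y;
  rewrite !mxE (h1 (x, y)).
by apply: eq_bigr => j _; rewrite !mxE; apply: (h2 (x, y, j)).
Qed.

Lemma near_map_const m n (A : 'M[F]_(m, n)) :
  U [set t | map_mx (e t) (map_mx k A) = map_mx (i t) A].
Proof.
have [_ _ hc _] := emb_e.
have h : U [set t | forall xy : 'I_m * 'I_n, e t (k (A xy.1 xy.2)) =
  i t (A xy.1 xy.2)].
  by apply: near_all_fin => xy; apply: hc.
by apply: filterS h => t /= h; apply/matrixP => x y; rewrite !mxE (h (x, y)).
Qed.

Lemma near_inj (x y : K) : U [set t | e t x = e t y] -> x = y.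
Proof.
have [hD _ _ hz] := emb_e => h; apply/eqP; rewrite -subr_eq0;
  apply/negPn/negP => nz.
have z : U [set t | e t (x - y) = 0].
  have h1 := hD (x - y) y; rewrite subrK in h1.
  apply: filterS2 h h1 => t /= hxy h1.
  by apply: (addIr (e t y)); rewrite add0r -h1 hxy.
have /filter_ex[t [/= z1 nz1]] :
  U ([set t | e t (x - y) = 0] `&` [set t | e t (x - y) <> 0]).
  by apply: filterI z _; apply: hz.
by [].
Qed.

Lemma near_inj_mx m n (X Y : 'M[K]_(m, n)) :
  U [set t | map_mx (e t) X = map_mx (e t) Y] -> X = Y.
Proof.
move=> h; apply/matrixP => x y; apply: near_inj;
  apply: filterS h => t /= /matrixP/(_ x y).
by rewrite !mxE.
Qed.

Lemma near_form m n p (A : 'M[F]_n) (X : 'M[K]_(m, n)) (Y : 'M[K]_(p, n)) :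
  U [set t | map_mx (e t) (X *m map_mx k A *m Y^T) =
      map_mx (e t) X *m map_mx (i t) A *m (map_mx (e t) Y)^T].
Proof.
apply: filterS3 (near_mulmx (X *m map_mx k A) Y^T) (near_mulmx X (map_mx k A))
  (near_map_const A) => t /=.
by move=> -> -> ->; rewrite map_trmx.
Qed.

Lemma near_qmap n (A : 'M[F]_n) (v : 'rV[K]_n) :
  U [set t | e t (qmap (map_mx k A) v) = qmap (map_mx (i t) A)
    (map_mx (e t) v)].
Proof.
apply: filterS (near_form A v v) => t /= /matrixP/(_ 0 0).
by rewrite mxE.
Qed.

Lemma near_anisotropic n (A : 'M[F]_n) :
  (forall t, anisotropic (map_mx (i t) A)) -> anisotropic (map_mx k A).
Proof.
move=> an v qv; apply: near_inj_mx.
apply: filterS2 (near_qmap A v) near_e0 => t /=.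
rewrite qv => h1 h0; rewrite h0 in h1; rewrite (an t (map_mx (e t) v)) //.
by apply/matrixP => x y; rewrite !mxE h0.
Qed.

End NearMatrices.

(** * Extension of an isometry as a transferable condition *)

Section EmbeddingProblem.
Variables (F : fieldType) (N : nat) (A G : 'M[F]_N).

(** A finite system of equations equivalent to the isometry condition for all c ([gramP]). Unlike a
    quantifier over the field, it passes along field morphisms in both directions and through
    ultrafilters. *)
Definition gram (L : fieldType) (i : {rmorphism F -> L}) t (T V :
  'M[L]_(t, N)) :=
  (forall j, qmap (map_mx i A) (row j T) = qmap (map_mx i G) (row j V)) /\
  T *m map_mx i (A + A^T) *m T^T = V *m map_mx i (G + G^T) *m V^T.

(* Vacuous unless T |-> V is an isometry; then y |-> w extends it. *)
Definition extends (L : fieldType) (i : {rmorphism F -> L}) t (T V :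
  'M[L]_(t, N))
    (y w : 'rV[L]_N) :=
  gram i T V ->
  qmap (map_mx i G) w = qmap (map_mx i A) y /\
  w *m map_mx i (G + G^T) *m V^T = y *m map_mx i (A + A^T) *m T^T.

Lemma gramP (L : fieldType) (i : {rmorphism F -> L}) t (T V : 'M[L]_(t, N)) :
  gram i T V <->
  forall c, qmap (map_mx i A) (c *m T) = qmap (map_mx i G) (c *m V).
Proof.
have e (B : 'M[F]_N) : map_mx i (B + B^T) = map_mx i B + (map_mx i B)^T.
  by rewrite map_mxD map_trmx.
split=> [[hq hp] c|h]; last first.
  split=> [j|]; first by rewrite !rowE h.
  apply/matrixP => x y; rewrite !e -!pmap_rows !rowE.
  exact: isom_pmap h _ _.
pose M := T *m map_mx i A *m T^T - V *m map_mx i G *m V^T.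
have altM : alternating M.
  have trE (X : 'M[L]_(t, N)) B : (X *m B *m X^T)^T = X *m B^T *m X^T.
    by rewrite !trmx_mul trmxK mulmxA.
  split=> [|j].
    move: hp; rewrite !e !mulmxDr !mulmxDl => hp.
    rewrite /M raddfB /= !trE opprB; apply/eqP; rewrite subr_eq addrAC -hp.
    by rewrite addrAC subrr add0r.
  have dE (X : 'M[L]_(t, N)) B : (X *m B *m X^T) j j = qmap B (row j X).
    rewrite /qmap [RHS]mxE mxE; apply: eq_bigr => s _.
    by rewrite -row_mul !mxE.
  by rewrite mxE dE mxE dE hq subrr.
have := qmap_alternating c altM;
  rewrite /qmap mulmxBr mulmxBl mxE [X in _ + X]mxE.
by move/eqP; rewrite subr_eq0 => /eqP; rewrite !trmx_mul !mulmxA.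
Qed.

Lemma extends_map (L M : fieldType) (i : {rmorphism F -> L}) (h :
  {rmorphism L -> M})
    (g : {rmorphism F -> M}) t (T V : 'M[L]_(t, N)) y w :
  (forall x, g x = h (i x)) -> extends i T V y w ->
  extends g (map_mx h T) (map_mx h V) (map_mx h y) (map_mx h w).
Proof.
move=> gE; have gm m n (B : 'M[F]_(m, n)) : map_mx g B = map_mx h (map_mx i B).
  by apply/matrixP => x z; rewrite !mxE gE.
rewrite /extends /gram !gm => H [hq hp].
have [|e1 e2] := H.
  split=> [j|].
    by apply: (fmorph_inj h); have := hq j; rewrite -!map_row !qmap_map.
  apply: (@map_mx_injective _ _ h); first exact: fmorph_inj.
  by rewrite !map_mxM -!map_trmx.
by rewrite !qmap_map e1 !map_trmx -!map_mxM e2.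
Qed.

Lemma extends_near (K : fieldType) (k : {rmorphism F -> K}) T0 (U :
  set_system T0)
    (L : T0 -> fieldType) (i : forall t, {rmorphism F -> L t}) (e :
      forall t, K -> L t)
    t (T V : 'M[K]_(t, N)) y w :
  ProperFilter U -> near_embedding k U i e ->
  U [set z | extends (i z) (map_mx (e z) T) (map_mx (e z) V)
               (map_mx (e z) y) (map_mx (e z) w)] ->
  extends k T V y w.
Proof.
move=> pU emb_e H [hq hp].
have gm : U [set z | gram (i z) (map_mx (e z) T) (map_mx (e z) V)].
  have h1 : U [set z | forall j, qmap (map_mx (i z) A)
    (row j (map_mx (e z) T)) =
      qmap (map_mx (i z) G) (row j (map_mx (e z) V))].
    apply: (near_all_fin pU) => j.
    apply: filterS2 (near_qmap pU emb_e A (row j T))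
      (near_qmap pU emb_e G (row j V)) => z /=.
    by rewrite -!map_row hq => -> ->.
  apply: filterS3 h1 (near_form pU emb_e (A + A^T) T T)
    (near_form pU emb_e (G + G^T) V V) => z /=.
  by move=> hz e1 e2; split=> //; rewrite -e1 -e2 hp.
split.
  apply: (near_inj pU emb_e).
  apply: filterS (filterI (filterI H gm) (filterI (near_qmap pU emb_e A y)
    (near_qmap pU emb_e G w))) => z /=.
  by case=> -[h g] [-> ->]; have [] := h g.
apply: (near_inj_mx pU emb_e).
apply: filterS (filterI (filterI H gm)
  (filterI (near_form pU emb_e (A + A^T) y T)
   (near_form pU emb_e (G + G^T) w V))) => z /=.
by case=> -[h g] [-> ->]; have [] := h g.
Qed.

End EmbeddingProblem.

Lemma abs_round_dbl (F : fieldType) N a (A : 'M[F]_N) :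
  abs_round A -> abs_round (dbl a A).
Proof. by move=> h M i; rewrite map_dbl; apply/round_dbl/h. Qed.

Lemma map_qb (F M : fieldType) (i : {rmorphism F -> M}) b :
  map_mx i (qb b) = qb (i b).
Proof. by rewrite map_block_mx map_mx0 !map_mx1 map_scalar_mx. Qed.

Lemma abs_round_pfister (F : fieldType) s (b : F) : abs_round (pfm s (qb b)).
Proof.
elim: s => [|a s IH]; last exact: abs_round_dbl.
by move=> M i; rewrite map_qb; apply: round_qb.
Qed.

Lemma abs_round_map (F L : fieldType) (i : {rmorphism F -> L}) N (A : 'M[F]_N) :
  abs_round A -> abs_round (map_mx i A).
Proof.
move=> h M j; have -> : map_mx j (map_mx i A) = map_mx (j \o i) A
  by rewrite -map_mx_comp.
exact: h.
Qed.

Lemma nondegenerate_map (F L : fieldType) (i : {rmorphism F -> L}) N (A :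
  'M[F]_N) :
  nondegenerate A -> nondegenerate (map_mx i A).
Proof. by rewrite /nondegenerate map_trmx -map_mxD map_unitmx. Qed.

Lemma dbl_values (K : fieldType) N (A : 'M[K]_N) x y u v :
    y != 0 -> anisotropic (dbl (- (x * y)) A) ->
  x * qmap A u = y * qmap A v -> u = 0 /\ v = 0.
Proof.
move=> nz_y an e; have e0 : row_mx (y *: v) u = 0.
  apply: an; rewrite qmap_dbl qmapZ.
  have -> : y ^+ 2 * qmap A v = y * (y * qmap A v) by ring.
  by rewrite -e; ring.
move/eqP: e0; rewrite row_mx_eq0 scaler_eq0 (negPf nz_y) /=.
by case/andP=> /eqP -> /eqP ->.
Qed.

(** * One extension step preserving three anisotropic forms *)

Section TripleStep.
Variables (F : fieldType) (r : nat) (A : 'M[F]_r).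
Hypotheses (ndA : nondegenerate A) (rdA : abs_round A).

(* <1, x> A - <1, y> A is Witt equivalent to x <1, - x y> A. *)
Definition anis3 (x y : F) (L : fieldType) (i : {rmorphism F -> L}) :=
  [/\ anisotropic (map_mx i (dbl x A)), anisotropic (map_mx i (dbl y A))
    & anisotropic (map_mx i (dbl (- (x * y)) A))].

Lemma anis3C x y (L : fieldType) (i : {rmorphism F -> L}) :
  @anis3 x y L i -> anis3 y x i.
Proof. by case=> h1 h2; rewrite mulrC => h3. Qed.

Lemma anis3_eq x y (L : fieldType) (i j : {rmorphism F -> L}) :
  i =1 j -> anis3 x y i -> anis3 x y j.
Proof.
move=> ij; have e N (X : 'M[F]_N) : map_mx j X = map_mx i X.
  by apply/matrixP => u v; rewrite !mxE ij.
by rewrite /anis3 !e.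
Qed.

(** In [extension_step] the target is [<1, y> A] and the other forms to protect are [<1, x> A] and
    [<1, - x y> A]. For each of these two, anisotropy of the other one bounds its common subforms
    with the target. *)
Lemma triple_step x y (L : fieldType) (i : {rmorphism F -> L}) t (T V :
  'M[L]_(t, r + r)) (z : 'rV[L]_(r + r)) :
    x != 0 -> y != 0 -> (t < r)%N -> anis3 x y i ->
  exists (M : fieldType) (h : {rmorphism L -> M}), anis3 x y (h \o i) /\
    exists w, extends (dbl x A) (dbl y A) (h \o i) (map_mx h T) (map_mx h V)
      (map_mx h z) w.
Proof.
move=> nz_x nz_y lt_tr an3.
have cE (M : fieldType) (h : {rmorphism L -> M}) m n (X : 'M[F]_(m, n)) :
    map_mx (h \o i) X = map_mx h (map_mx i X) by rewrite -map_mx_comp.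
have idE m n (X : 'M[F]_(m, n)) : map_mx (idfun \o i) X = map_mx i X
  by rewrite cE map_mx_id.
have [gm|ngm] := EM (gram (dbl x A) (dbl y A) i T V); last first.
  exists L, idfun; split; first by apply: anis3_eq an3.
  by exists 0 => gm; case: ngm; move: gm; rewrite /gram !idE !map_mx_id.
have [anx any anz] := an3.
pose XX (X : 'M[L]_(r + r)) := X = map_mx i (dbl x A) \/ X =
  map_mx i (dbl (- (x * y)) A).
have ndy : nondegenerate (map_mx i (dbl y A))
  by apply/nondegenerate_map/nondegenerate_dbl.
have rd c : abs_round (map_mx i (dbl c A)) by apply/abs_round_map/abs_round_dbl.
have mE c : map_mx i (dbl c A) = dbl (i c) (map_mx i A) by rewrite map_dbl.
have lt_N : (t + r < r + r)%N by rewrite ltn_add2r.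
have subX X : XX X -> forall n (D g : 'M_(n, r + r)),
    (forall c, qmap (map_mx i (dbl y A)) (c *m D) = qmap X (c *m g)) ->
      (\rank D <= r)%N.
  have ndA' := nondegenerate_map i ndA.
  case=> -> n D g; rewrite !mE; apply: common_subform => // u v e.
    apply: dbl_values e; first by rewrite fmorph_eq0.
    by rewrite -rmorphM -rmorphN -mE.
  have e0 : row_mx v u = 0.
    apply: anx; rewrite mE qmap_dbl; apply: (mulfI (x := i y)); first
      by rewrite fmorph_eq0.
    by move: e; rewrite rmorphN rmorphM /= mulr0 mulrDr => <-; ring.
  by move/eqP: e0; rewrite row_mx_eq0 => /andP[/eqP -> /eqP ->].
have anX X : XX X -> anisotropic X by case=> ->.
have rdX X : XX X -> abs_round X by case=> ->; apply: rd.
have [M [h [w [anyM anXM qw lw]]]] :=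
  extension_step z lt_N anx any ndy (rd y) anX rdX subX
    (proj1 (gramP _ _ _ _ _) gm).
exists M, h; split.
  by split; rewrite cE //; apply: anXM; [left | right].
exists w => _; rewrite !cE qw qmap_map; split=> //.
by move: lw; rewrite !map_mxM !map_mxD !map_trmx !mulmxA.
Qed.

End TripleStep.

Lemma map_mx_data (R S : Type) (h : R -> S) t N (d : 'M[R]_(t + t + 1, N)) :
  [/\ usubmx (usubmx (map_mx h d)) = map_mx h (usubmx (usubmx d)),
      dsubmx (usubmx (map_mx h d)) = map_mx h (dsubmx (usubmx d))
    & dsubmx (map_mx h d) = map_mx h (dsubmx d)].
Proof. by split; apply/matrixP => i j; rewrite !mxE. Qed.

(** * The field over which all extension problems are solvable *)

Section LinkField.
Variables (F : fieldType) (r : nat) (A : 'M[F]_r) (a b : F).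
Hypotheses (ndA : nondegenerate A) (rdA : abs_round A) (r_gt0 : (0 < r)%N).
Hypotheses (nz_a : a != 0) (nz_b : b != 0) (an3 : anis3 A a b idfun).

Lemma link_field : exists (K : fieldType) (k : {rmorphism F -> K}),
  anis3 A a b k /\ forall x y, (x = a /\ y = b) \/ (x = b /\ y = a) ->
    forall t (T V : 'M[K]_(t, r + r)) z, (t < r)%N ->
    exists w, extends (dbl x A) (dbl y A) k T V z w.
Proof.
(* A problem is a direction between the two forms and the number of vectors already mapped, less
   than r; its data stack T, V and the new vector, hence the [+ 1]. *)
pose I := (bool * 'I_r)%type; pose ar (p : I) := (p.2 + p.2 + 1)%N.
pose src (c : bool) := if c then a else b.
pose sol (p : I) (L : fieldType) (i : {rmorphism F -> L}) (d :
  'M[L]_(ar p, r + r)) w :=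
  extends (dbl (src p.1) A) (dbl (src (~~ p.1)) A) i
    (usubmx (usubmx d)) (dsubmx (usubmx d)) (dsubmx d) w.
have [||||||K [k [gk hk]]] := @closure_field F I ar (r + r) (fun L i =>
  anis3 A a b i) sol.
- by rewrite addn_gt0 r_gt0.
- by exists F, idfun.
- move=> p L M i h g d s gE H.
  have [e1 e2 e3] := map_mx_data h (d : 'M_(p.2 + p.2 + 1, _)).
  by rewrite /sol e1 e2 e3; apply: extends_map gE H.
- move=> p L i d gi.
  have an' : anis3 A (src p.1) (src (~~ p.1)) i.
    by case: (p.1) => //=; apply: anis3C.
  have nz c : src c != 0 by case: c.
  have [M [h [anM hw]]] := triple_step ndA rdA (usubmx (usubmx d))
    (dsubmx (usubmx d))
    (dsubmx d) (nz _) (nz _) (ltn_ord p.2) an'.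
  exists M, h; split; first by move: anM; case: (p.1) => //=; apply: anis3C.
  have [e1 e2 e3] := map_mx_data h (d : 'M_(p.2 + p.2 + 1, _)).
  by case: hw => w hw; exists w; rewrite /sol e1 e2 e3.
- move=> K k T U L i e pU emb_e gi; split; apply: (near_anisotropic pU emb_e) =>
  t;
    by case: (gi t).
- move=> K k T U L i e p d s pU emb_e H; apply: (extends_near pU emb_e).
  apply: filterS H => t /=; have [e1 e2 e3] :=
    map_mx_data (e t) (d : 'M_(p.2 + p.2 + 1, _)).
  by rewrite /sol e1 e2 e3.
exists K, k; split=> // x y xy t T V z lt_tr.
have [c [-> ->]] : exists c, x = src c /\ y = src (~~ c).
  by case: xy => -[-> ->]; [exists true | exists false].
have [w hw] := hk (c, Ordinal lt_tr) (col_mx (col_mx T V) z).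
exists w; move: hw; rewrite /sol /=.
have -> : usubmx (usubmx (col_mx (col_mx T V) z)) = T by rewrite !col_mxKu.
have -> : dsubmx (usubmx (col_mx (col_mx T V) z)) = V
  by rewrite col_mxKu col_mxKd.
by have -> : dsubmx (col_mx (col_mx T V) z) = z by rewrite col_mxKd.
Qed.

End LinkField.

(** Rows are mapped one at a time; the last step extends an isometry on at most [r - 1] vectors,
    hence the bound r. *)
Lemma embed_rows (F K : fieldType) (k : {rmorphism F -> K}) N r (A G :
  'M[F]_N) :
    (forall t (T V : 'M[K]_(t, N)) z, (t < r)%N ->
       exists w, extends A G k T V z w) ->
  forall t (Y : 'M[K]_(t, N)), (t <= r)%N ->
    exists Z : 'M_(t, N), forall c,
      qmap (map_mx k G) (c *m Z) = qmap (map_mx k A) (c *m Y).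
Proof.
move=> ext; elim=> [|t IH] Y le_tr.
  by exists 0 => c; rewrite [Y]flatmx0 !mulmx0 !qmap0.
pose y : 'rV_N := @usubmx _ 1 t N Y; pose Y' : 'M_(t, N) := @dsubmx _ 1 t N Y.
have [Z' hZ'] := IH Y' (ltnW le_tr).
have [w] := ext t Y' Z' y le_tr; rewrite /extends => hw.
have [|qw pw] := hw; first by apply/gramP => c; rewrite hZ'.
exists (col_mx w Z' : 'M_(1 + t, N)) => c.
rewrite -[Y](@vsubmxK _ 1 t N) -/y -/Y'.
have e c0 (c' : 'rV_t) : qmap (map_mx k G) (row_mx c0 c' *m col_mx w Z') =
    qmap (map_mx k A) (row_mx c0 c' *m col_mx y Y').
  rewrite !mul_row_col [c0]mx11_scalar !mul_scalar_mx !qmapD !qmapZ !pmapZl hZ'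
    qw.
  congr (_ + _ * _); rewrite /pmap !trmx_mul !mulmxA.
  by move: pw; rewrite !map_mxD !map_trmx => ->.
by rewrite -[c](@hsubmxK _ 1 1 t).
Qed.

Section EmbeddingTransport.
Variables (F K : fieldType) (k : {rmorphism F -> K}).

(** F may be finite, so the identity for all vectors over F is first turned into an identity of
    matrices up to an alternating one, which does pass to K. *)
Lemma emb_map N N' (A : 'M[F]_N) (A' : 'M[F]_N') :
  emb A A' -> emb (map_mx k A) (map_mx k A').
Proof.
case=> P hP; pose M := P *m A' *m P^T - A.
have altM : alternating M.
  apply: alternating_of_qmap => v;
    rewrite /qmap mulmxBr mulmxBl [LHS]mxE [X in _ + X]mxE.
  by have := hP v; rewrite /qmap trmx_mul !mulmxA => ->; rewrite subrr.
exists (map_mx k P) => v; have : qmap (map_mx k M) v = 0.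
  apply: qmap_alternating; case: altM => skM diM; split=> [|j].
    by rewrite map_trmx skM map_mxN.
  by rewrite mxE diM rmorph0.
rewrite map_mxB !map_mxM -map_trmx /qmap mulmxBr mulmxBl [LHS]mxE
  [X in _ + X]mxE.
by move/eqP; rewrite subr_eq0 trmx_mul !mulmxA => /eqP.
Qed.

Lemma emb_map_pfm s N (A : 'M[F]_N) :
  emb (map_mx k (pfm s A)) (pfm (map k s) (map_mx k A)) /\
  emb (pfm (map k s) (map_mx k A)) (map_mx k (pfm s A)).
Proof.
elim: s => [|a s [IH1 IH2]] /=; first by split; apply: emb_refl.
by rewrite map_dbl; split; apply: emb_dbl.
Qed.

Lemma nondegenerate_emb N N' (A : 'M[F]_N) (A' : 'M[F]_N') :
  N = N' -> emb A' A -> nondegenerate A' -> nondegenerate A.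
Proof.
move=> e; subst N' => -[P hP] ndA'.
have e : P *m (A + A^T) *m P^T = A' + A'^T.
  apply/matrixP => i j; have := isom_pmap1 hP (delta_mx 0 i) (delta_mx 0 j).
  by rewrite /pmap -entry_delta trmx_mul !mulmxA -(mulmxA _ P)
    -(mulmxA _ (P *m _)) -entry_delta.
by move: ndA'; rewrite /nondegenerate -e !unitmx_mul => /andP[/andP[]].
Qed.

End EmbeddingTransport.

(** * Transfer of factors between the linked forms *)

Section LinkedForms.
Variables (F : fieldType) (s : seq F) (b0 a b : F).
Hypotheses (nz_s : nonzeros s) (nz_b0 : 1 - 4 * b0 != 0) (nz_a : a != 0) (nz_b :
  b != 0).
Let rho := pfm s (qb b0).
Hypothesis anA : anisotropic (dbl a rho).

Lemma nd_rho : nondegenerate rho.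
Proof. exact/nondegenerate_pfm/nondegenerate_qb. Qed.

(* If rho represents a b, then <1, a> rho = <1, b> rho. *)
Lemma common_third : ~ emb (dbl a rho) (dbl b rho) ->
  anisotropic (dbl (- (a * b)) rho).
Proof.
move=> neq v; rewrite qmap_dblE => qv.
have anR := anisotropic_dbl anA.
have rdR : round rho by apply/round_pfm/round_qb.
have [y0|nz_y] := eqVneq (qmap rho (rsubmx v)) 0.
  rewrite -[v]hsubmxK (anR _ y0); move: qv; rewrite y0 mulr0 addr0 => /anR ->.
  exact: row_mx0.
case: neq; have sy := rdR _ nz_y.
have ex : qmap rho (lsubmx v) = a * b * qmap rho (rsubmx v).
  by apply/eqP; rewrite -subr_eq0 -mulNr qv.
have nz_x : qmap rho (lsubmx v) != 0 by rewrite ex !mulf_neq0.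
have sab : similar rho (a * b).
  have := similarM (rdR _ nz_x) (similarV nz_y sy); rewrite ex.
  by rewrite mulfK.
have sc : similar rho (a^-1 ^+ 2) by exists (a^-1%:M) => u;
  rewrite mul_mx_scalar qmapZ.
have nz : a * b * a^-1 ^+ 2 != 0 by rewrite !mulf_neq0 // invr_eq0.
have := emb_dbl_similar a nz (similarM sab sc).
by rewrite (_ : a * _ = b) //; field.
Qed.

Variables (K : fieldType) (k : {rmorphism F -> K}).
Hypothesis linkK : forall x y, (x = a /\ y = b) \/ (x = b /\ y = a) ->
    forall t (T V : 'M[K]_(t, _)) z, (t < pfd s (1 + 1))%N ->
    exists w, extends (dbl x rho) (dbl y rho) k T V z w.

(** A factor of phi is a subform of it, is copied into psi by [embed_rows], and is a factor there by
    [subform_factor]. *)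
Lemma factor_transfer x y (phi psi tau : qform K) m :
    (x = a /\ y = b) \/ (x = b /\ y = a) -> (m <= size s)%N ->
    anisotropic (map_mx k (dbl y rho)) ->
    emb (qmx phi) (map_mx k (dbl x rho)) ->
    emb (qmx psi) (map_mx k (dbl y rho)) -> emb (map_mx k (dbl y rho))
      (qmx psi) ->
    qdim psi = (pfd s (1 + 1) + pfd s (1 + 1))%N ->
    qpfister m.+1 tau -> pfactor (size s).+2 m.+1 tau phi ->
  pfactor (size s).+2 m.+1 tau psi.
Proof.
move=> xy le_ms anY hphi hpsi hpsi' dpsi [t [be [[st] nz_t nz_be iso_tau]]].
case=> B [[u [su nz_u iso_B]] iso_phi].
have [dtau tau1 tau2] := qisometric_emb iso_tau.
pose sig := pfm t (qb be).
have sig_tau : emb sig (qmx tau).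
  exact: emb_trans (emb_pfm_qtens t (qbin be)) tau2.
have ndsig : nondegenerate sig by apply/nondegenerate_pfm/nondegenerate_qb.
have dsig : pfd t (1 + 1) = qdim tau by rewrite dtau (qdim_qtens t (qbin be)).
have tau_sig : emb (qmx tau) sig by apply: emb_inv dsig ndsig sig_tau.
have [_ _ B2] := qtens_congr iso_B (qisometric_refl tau).
have [_ _ phi2] := qisometric_emb iso_phi.
have [P hP] : emb sig (map_mx k (dbl x rho)).
  apply: emb_trans sig_tau _.
  have h1 : emb (qmx tau) (pfm u (qmx tau)) by exists (pfi u _) => v;
    apply: qmap_pfi.
  apply: emb_trans h1 _; apply: emb_trans (emb_pfm_qtens u tau) _.
  exact: emb_trans B2 (emb_trans phi2 hphi).
(* The (m+1)-fold form has dimension [2 ^ (m+1)], and rho has dimension [2 ^ (size s + 1)]. *)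
have le_dim : (pfd t (1 + 1) <= pfd s (1 + 1))%N.
  by rewrite !pfdE leq_mul2r leq_exp2l // st.
have [Z hZ] := embed_rows (linkK xy) P le_dim.
pose sK := map k (y :: s); pose bK := k b0.
have nz_y : y != 0 by case: xy => -[_ ->].
have nz_sK : nonzeros sK.
  rewrite /nonzeros all_map /= fmorph_eq0 nz_y /=; apply: sub_all nz_s => z /=.
  by rewrite fmorph_eq0.
have nz_bK : 1 - 4 * bK != 0.
  rewrite (_ : _ - _ = k (1 - 4 * b0)) ?fmorph_eq0 //.
  by rewrite rmorphB rmorph1 rmorphM rmorph_nat.
have [hY1 hY2] := emb_map_pfm k (y :: s) (qb b0); rewrite map_qb in hY1 hY2.
have ndK : nondegenerate (pfm sK (qb bK))
  by apply/nondegenerate_pfm/nondegenerate_qb.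
have anK : anisotropic (pfm sK (qb bK)) := emb_anisotropic ndK hY2 anY.
have [Q hQ] := hY1.
have [|s' [ss' nz_s' h]] := subform_factor (J :=
  Z *m Q) nz_bK nz_be nz_sK nz_t anK.
  by move=> v; rewrite mulmxA hQ hZ hP.
have es' : size s' = ((size s).+2 - m.+1)%N.
  by rewrite subSS -st; have := ss'; rewrite /sK size_map /= => <-;
    rewrite addnK.
exists (bpf s'); split; first by exists s'; split=> //; apply: bisometric_refl.
have hall : emb (qmx psi) (qmx (qtens (bpf s') tau)).
  apply: emb_trans hpsi _; apply: emb_trans hY1 _; apply: emb_trans h _.
  apply: emb_trans (emb_pfm s' sig_tau) _.
  exact: emb_pfm_qtens.
have ndY : nondegenerate (map_mx k (dbl y rho)).
  by apply/nondegenerate_map/nondegenerate_dbl/nd_rho.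
apply: emb_qisometric hall; last exact: nondegenerate_emb hpsi' ndY.
rewrite qdim_qtens -dsig !pfdE mulnA -expnD ss' size_map dpsi !pfdE /=.
by rewrite expnS mul2n addnn -doubleMl.
Qed.

End LinkedForms.

(** * The linked extension *)

Section NormalForm.
Variables (F : fieldType) (s : seq F) (b0 : F) (n : nat) (phi rho' : qform F).
Hypotheses (nz_s : nonzeros s) (nz_b0 : 1 - 4 * b0 != 0).
Hypothesis iso_rho : qisometric rho' (qtens (bpf s) (qbin b0)).
Let rho := pfm s (qb b0).

Lemma factor_normal_form : (0 < n)%N -> pfactor n (n - 1) rho' phi -> exists a,
  [/\ a != 0, qdim phi = (pfd s (1 + 1) + pfd s (1 + 1))%N,
      nondegenerate (qmx phi), emb (dbl a rho) (qmx phi) &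
        emb (qmx phi) (dbl a rho)].
Proof.
move=> n_gt0 [B [[u [su nz_u iso_B]] iso_phi]].
move: su nz_u iso_B; rewrite subKn //; case: u =>
  [|a [|c u]] //= _ /andP[nz_a _] iso_B.
have [dphi _ phi2] := qisometric_emb iso_phi.
have [dB _ B2] := qtens_congr iso_B (qisometric_refl rho').
have [drho _ rho2] := qisometric_emb iso_rho.
have h : emb (dbl a rho) (qmx phi).
  apply: emb_trans (emb_trans B2 phi2).
  apply: emb_trans (emb_pfm_qtens [:: a] rho') => /=; apply: emb_dbl.
  exact: emb_trans (emb_pfm_qtens s (qbin b0)) rho2.
have d : qdim phi = (pfd s (1 + 1) + pfd s (1 + 1))%N.
  by rewrite dphi dB (qdim_qtens [:: a]) drho (qdim_qtens s (qbin b0)).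
have nd : nondegenerate (dbl a rho)
  by apply/nondegenerate_dbl/nondegenerate_pfm/nondegenerate_qb.
exists a; split=> //; first exact: nondegenerate_emb d h nd.
exact: emb_inv (esym d) nd h.
Qed.

Lemma nonhyperbolic_anisotropic a : a != 0 -> ~ hyperbolic phi ->
    qdim phi = (pfd s (1 + 1) + pfd s (1 + 1))%N -> nondegenerate (qmx phi) ->
  emb (qmx phi) (dbl a rho) -> anisotropic (dbl a rho).
Proof.
move=> nz_a nh d nd h; apply: contrapT => iso; case: nh.
have [|k [ek hk]] := @isotropic_pfister _ (a :: s) b0 _ iso; first
  by rewrite /= nz_a.
by apply: (@hyperbolic_of_emb _ _ k) => //;
  [rewrite d; apply: esym ek | apply: emb_trans h hk].
Qed.

End NormalForm.

Theorem theorem4p3 (F : fieldType) (n m : nat) (phi psi : qform F)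
    (hn : (2 <= n)%N) (hm : (1 <= m <= n - 1)%N) (hmn : m.+1 <> n)
    (hphi : qpfister n phi) (hpsi : qpfister n psi)
    (hneq : ~ qisometric phi psi)
    (hphi_nh : ~ hyperbolic phi) (hpsi_nh : ~ hyperbolic psi)
    (hlink : sep_linked n (n - 1) phi psi)
    (htot : tot_sep_linked n m phi psi) :
  exists (K : fieldType) (iota : {rmorphism F -> K}),
    [/\ tot_sep_linked n m.+1 (qscal iota phi) (qscal iota psi),
        ~ qisometric (qscal iota phi) (qscal iota psi),
        ~ hyperbolic (qscal iota phi)
      & ~ hyperbolic (qscal iota psi)].
Proof.
have n_gt0 := ltnW hn.
have [rho' [[s [b0 [ss nz_s nz_b0 iso_rho]]] fphi fpsi]] := hlink.
have en : n = (size s).+2 by rewrite ss -addn1 subnK.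
have [a [nz_a dphi ndphi phi1 phi2]] :=
  factor_normal_form nz_s nz_b0 iso_rho n_gt0 fphi.
have [b [nz_b dpsi ndpsi psi1 psi2]] :=
  factor_normal_form nz_s nz_b0 iso_rho n_gt0 fpsi.
have anA := nonhyperbolic_anisotropic nz_s nz_a hphi_nh dphi ndphi phi2.
have anB := nonhyperbolic_anisotropic nz_s nz_b hpsi_nh dpsi ndpsi psi2.
set rho := pfm s (qb b0) in anA anB phi1 phi2 psi1 psi2.
have ndR : nondegenerate rho by apply/nondegenerate_pfm/nondegenerate_qb.
have rdR : abs_round rho by apply: abs_round_pfister.
have r_gt0 : (0 < pfd s (1 + 1))%N by rewrite pfdE muln_gt0 expn_gt0.
have anC : anisotropic (dbl (- (a * b)) rho).
  apply: common_third => // hab; apply: hneq; apply: emb_qisometric => //.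
    by rewrite dphi dpsi.
  exact: emb_trans phi2 (emb_trans hab psi1).
have an3 : anis3 rho a b idfun by split; rewrite map_mx_id.
have [K [k [[anAK anBK anCK] linkK]]] := link_field ndR rdR r_gt0 nz_a nz_b an3.
(* As [m + 1 <> n], m is at most [n - 2 = size s], which keeps (m+1)-fold forms within the dimension
   of rho. *)
exists K, k; have le_ms : (m <= size s)%N.
  by move: hm hmn; rewrite en subn1 /= => /andP[_];
    rewrite leq_eqVlt => /predU1P[->|].
have anphi : anisotropic (qmx (qscal k phi)).
  by apply: emb_anisotropic (emb_map k phi2) anAK; apply: nondegenerate_map.
have anpsi : anisotropic (qmx (qscal k psi)).
  by apply: emb_anisotropic (emb_map k psi2) anBK; apply: nondegenerate_map.
split.
- have tr := factor_transfer nz_s nz_b0 nz_a nz_b linkK.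
  move=> tau ptau; rewrite en; split.
    apply: (tr a b (qscal k phi) (qscal k psi)) (emb_map k phi2)
      (emb_map k psi2)
      (emb_map k psi1) dpsi ptau => //.
    by left.
  apply: (tr b a (qscal k psi) (qscal k phi)) (emb_map k psi2) (emb_map k phi2)
    (emb_map k phi1) dphi ptau => //.
  by right.
- case/qisometric_emb=> _ _ h.
  have [P hP] := emb_trans (emb_map k psi1) (emb_trans h (emb_map k phi2)).
  have ndRK := nondegenerate_map k ndR.
  (* An isometry would make the whole space, of dimension 2r, a common subform, against the bound
     r. *)
  have : (\rank (1%:M :
    'M[K]_(pfd s (1 + 1) + pfd s (1 + 1))) <= pfd s (1 + 1))%N.
    apply: (@common_subform _ _ (map_mx k rho) (k a) (k b) _ _ P) => // [u v|c].
      apply: dbl_values; first by rewrite fmorph_eq0.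
      by rewrite -rmorphM -rmorphN; move: anCK; rewrite map_dbl.
    by rewrite mulmx1; have := hP c; rewrite !map_dbl => ->.
  by rewrite mxrank1 -[X in (_ <= X)%N]addn0 leq_add2l leqNgt r_gt0.
- by apply: anisotropic_nonhyperbolic anphi; rewrite dphi addn_gt0 r_gt0.
- by apply: anisotropic_nonhyperbolic anpsi; rewrite dpsi addn_gt0 r_gt0.
Qed.
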